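(* Let $A \in \mathcal{H}_{\alpha}(\mathbb{R}^{\mathbb{N}})$ and let $A'\in \mathcal{H}_{\alpha}(\overline{\mathbb{R}}^{\mathbb{N}})$ be its unique $\alpha$-Hölder extension. Suppose there exists $z_0 \in \mathbb{R}$ such that $$A'(x_1, \ldots, x_{n-1}, \pm\infty, x_{n+1}, \ldots) < A'(x_1, \ldots, x_{n-1}, z_0, x_{n+1}, \ldots)$$ for all $x \in \overline{\mathbb{R}}^{\mathbb{N}}$, all $n \in \mathbb{N}$ and both choices of sign. Then: (a) Any maximizing measure $\mu_{\infty}$ of $A'$ has support contained in $\mathbb{R}^{\mathbb{N}}$; therefore $\mu_{\infty}$ is a maximizing measure of $A$. (b) $A$ has a calibrated sub-action $V$ defined on $\mathbb{R}^{\mathbb{N}}$, i.e. there is a continuous function $V:\mathbb{R}^{\mathbb{N}}\to\mathbb{R}$ such that for all $x\in\mathbb{R}^{\mathbb{N}}$ $$m(A) = \max_{a \in \mathbb{R}}\{A(ax) + V(ax) - V(x)\}.$$ (c) $\lim_{\beta \to \infty}\frac{1}{\beta}\log(\lambda_{\beta A}) = m(A)$.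
   Context: Points of $\mathbb{R}^{\mathbb{N}}$ are $x=(x_1,x_2,\ldots)$; $\sigma$ is the left shift; $ax=(a,x_1,x_2,\ldots)$. The metric on $\mathbb{R}^{\mathbb{N}}$ is $d(x,y)=\sum_{n\ge 1}\frac{1}{\pi 2^n}|\arctan(x_n)-\arctan(y_n)|$. Let $\overline{\mathbb{R}}=\mathbb{R}\cup\{\pm\infty\}$ with $\arctan(\pm\infty)=\lim_{t\to\pm\infty}\arctan(t)=\pm\pi/2$; the same formula defines a metric $\widehat d$ on $\overline{\mathbb{R}}^{\mathbb{N}}$, which is then a compact metric space. $\mathcal{H}_\alpha(X)$ denotes real-valued $\alpha$-Hölder functions on the metric space $X$ (exponent $\alpha\in(0,1]$ fixed). Every $A\in\mathcal{H}_\alpha(\mathbb{R}^{\mathbb{N}})$ has a unique extension $A'\in\mathcal{H}_\alpha(\overline{\mathbb{R}}^{\mathbb{N}})$. Fix a strictly positive continuous $f:\mathbb{R}\to\mathbb{R}$ with $\int_{\mathbb{R}} f(a)\,da=1$. The Ruelle operator is $\mathcal{L}_A(\varphi)(x)=\int_{\mathbb{R}} e^{A(ax)}\varphi(ax)f(a)\,da$. For $\beta>0$, $\lambda_{\beta A}>0$ denotes the (main, simple) eigenvalue of $\mathcal{L}_{\beta A}$ possessing a strictly positive $\alpha$-Hölder eigenfunction. For a continuous bounded potential $B$ on $X=\mathbb{R}^{\mathbb{N}}$ or $\overline{\mathbb{R}}^{\mathbb{N}}$, $m(B)=\sup\{\int B\,d\mu:\mu\text{ a }\sigma\text{-invariant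 Borel probability measure on }X\}$, and a maximizing measure of $B$ is a $\sigma$-invariant Borel probability $\mu$ on $X$ with $\int B\,d\mu=m(B)$. *)

(* Defs.v *)
From HB Require Import structures.
From mathcomp Require Import all_boot all_order all_algebra.
From mathcomp Require Import all_classical all_reals all_analysis.

Set Implicit Arguments.
Unset Strict Implicit.
Unset Printing Implicit Defensive.

Import Order.TTheory GRing.Theory Num.Theory.
Import numFieldNormedType.Exports.

Local Open Scope classical_set_scope.
Local Open Scope ring_scope.

(* Sequences are indexed from 0: the coordinate written x_(n+1) in the
   literature is [x n], hence the weight 1 / (pi * 2 ^ (n + 1)) below. *)

Section arctan_series.
Context {R : realType}.
Implicit Types u v w : nat -> R.

Definition wdist_term u v (n : nat) : R :=
  (pi * 2 ^+ n.+1)^-1 * `|u n - v n|.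

Definition wdist u v : R := limn (series (wdist_term u v)).

Let bnd u := forall n, `|u n| <= pi / 2.

Let pi2_gt0 (n : nat) : 0 < pi * 2 ^+ n.+1 :> R.
Proof. by rewrite mulr_gt0 ?pi_gt0// exprn_gt0. Qed.

Lemma wdist_term_ge0 u v n : 0 <= wdist_term u v n.
Proof. by rewrite mulr_ge0// invr_ge0 ltW. Qed.

Lemma is_cvg_wdist u v : bnd u -> bnd v -> cvgn (series (wdist_term u v)).
Proof.
move=> bu bv; apply: (@series_le_cvg _ _ (geometric 2^-1 2^-1)).
- exact: wdist_term_ge0.
- by move=> n /=; rewrite mulr_ge0// exprn_ge0.
- move=> n /=; rewrite /wdist_term -exprS exprVn invfM mulrAC.
  rewrite ler_piMl ?invr_ge0 ?exprn_ge0// mulrC ler_pdivrMr ?pi_gt0// mul1r.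
  by rewrite (le_trans (ler_normB _ _))// [leRHS]splitr lerD.
- apply/cvg_ex; eexists; apply: cvg_geometric_series.
  by rewrite ger0_norm// invf_lt1// ltr1n.
Qed.

Lemma wdistxx u : wdist u u = 0.
Proof.
rewrite /wdist (_ : series _ = fun=> 0) ?lim_cst//.
apply/funext => n; rewrite /series/= big1// => i _.
by rewrite /wdist_term subrr normr0 mulr0.
Qed.

Lemma wdist_sym u v : wdist u v = wdist v u.
Proof.
rewrite /wdist; congr (limn (series _)); apply/funext => n.
by rewrite /wdist_term distrC.
Qed.

Lemma wdist_triangle v u w : bnd u -> bnd v -> bnd w ->
  wdist u w <= wdist u v + wdist v w.
Proof.
move=> bu bv bw.
have [cuv cvw] := (is_cvg_wdist bu bv, is_cvg_wdist bv bw).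
rewrite /wdist -lim_seriesD//; apply: lim_series_le.
- exact: is_cvg_wdist.
- by rewrite seriesD; exact: is_cvgD.
- move=> n; rewrite /wdist_term /= -mulrDr ler_wpM2l ?invr_ge0 ?(ltW (pi2_gt0 _))//.
  exact: ler_distD.
Qed.

Lemma wdist_eq0 u v : bnd u -> bnd v -> wdist u v = 0 -> u =1 v.
Proof.
move=> bu bv uv0 n; have cuv := is_cvg_wdist bu bv.
have : series (wdist_term u v) n.+1 <= 0.
  rewrite -uv0; apply: nondecreasing_cvgn_le => //.
  apply/nondecreasing_seqP => k; rewrite seriesSr lerDl.
  exact: wdist_term_ge0.
rewrite seriesSr => /(le_trans _) le0.
have /le0 : wdist_term u v n <= series (wdist_term u v) n + wdist_term u v n.
  by rewrite lerDr sumr_ge0// => i _; exact: wdist_term_ge0.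
rewrite /wdist_term pmulr_rle0 ?invr_gt0// normr_le0 subr_eq0.
by move/eqP.
Qed.

End arctan_series.

Definition atane {R : realType} (x : \bar R) : R :=
  match x with
  | a%:E => atan a
  | +oo%E => pi / 2
  | -oo%E => - (pi / 2)
  end.

Lemma atan_bound {R : realType} (a : R) : `|atan a| <= pi / 2.
Proof. by rewrite ler_norml !ltW// ?atan_gtNpi2 ?atan_ltpi2. Qed.

Lemma atane_bound {R : realType} (x : \bar R) : `|atane x| <= pi / 2.
Proof.
case: x => [a| |] /=; first exact: atan_bound.
- by rewrite ger0_norm// divr_ge0// pi_ge0.
- by rewrite normrN ger0_norm// divr_ge0// pi_ge0.
Qed.

Lemma atan_inj {R : realType} : injective (@atan R).
Proof. exact: (can_inj (@atanK R)). Qed.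

Lemma atane_inj {R : realType} : injective (@atane R).
Proof.
have p0 : 0 < pi / 2 :> R by rewrite divr_gt0// pi_gt0.
have np : - (pi / 2) < pi / 2 :> R by rewrite (lt_trans _ p0)// oppr_lt0.
move=> [a| |] [b| |] //= h.
- by rewrite (atan_inj h).
- by have := atan_ltpi2 a; rewrite h ltxx.
- by have := atan_gtNpi2 a; rewrite h ltxx.
- by have := atan_ltpi2 b; rewrite -h ltxx.
- by move: np; rewrite -h ltxx.
- by have := atan_gtNpi2 b; rewrite -h ltxx.
- by move: np; rewrite h ltxx.
Qed.

(* [RN R] and [eRN R] carry the metrics d and \hat d.  They are aliases, so
   that the product topology that the library puts on plain function types
   is not picked up instead. *)
Definition RN (R : realType) : Type := nat -> R.
Definition eRN (R : realType) : Type := nat -> \bar R.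

Section RN_metric.
Context {R : realType}.

Definition RN_dist (x y : RN R) : R := wdist (atan \o x) (atan \o y).

Let dxx x : RN_dist x x = 0. Proof. exact: wdistxx. Qed.

Let d_eq0 x y : RN_dist x y = 0 -> x = y.
Proof.
move=> /wdist_eq0 h; apply/funext => n; apply: atan_inj.
by apply: h => k; exact: atan_bound.
Qed.

Let d_sym x y : RN_dist x y = RN_dist y x. Proof. exact: wdist_sym. Qed.

Let d_triangle y x z : RN_dist x z <= RN_dist x y + RN_dist y z.
Proof. by apply: wdist_triangle => k; exact: atan_bound. Qed.

HB.instance Definition _ := Choice.copy (RN R) (nat -> R).
HB.instance Definition _ := isPointed.Build (RN R) (fun=> 0).
HB.instance Definition _ := isMetric.Build R (RN R) dxx d_eq0 d_sym d_triangle.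

End RN_metric.

Section eRN_metric.
Context {R : realType}.

Definition eRN_dist (x y : eRN R) : R := wdist (atane \o x) (atane \o y).

Let dxx x : eRN_dist x x = 0. Proof. exact: wdistxx. Qed.

Let d_eq0 x y : eRN_dist x y = 0 -> x = y.
Proof.
move=> /wdist_eq0 h; apply/funext => n; apply: atane_inj.
by apply: h => k; exact: atane_bound.
Qed.

Let d_sym x y : eRN_dist x y = eRN_dist y x. Proof. exact: wdist_sym. Qed.

Let d_triangle y x z : eRN_dist x z <= eRN_dist x y + eRN_dist y z.
Proof. by apply: wdist_triangle => k; exact: atane_bound. Qed.

HB.instance Definition _ := Choice.copy (eRN R) (nat -> \bar R).
HB.instance Definition _ := isPointed.Build (eRN R) (fun=> 0%:E).
HB.instance Definition _ := isMetric.Build R (eRN R) dxx d_eq0 d_sym d_triangle.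

End eRN_metric.

Definition RN_incl {R : realType} (x : RN R) : eRN R := fun n => (x n)%:E.

Definition seq_shift {T : Type} (x : nat -> T) : nat -> T := fun n => x n.+1.

Definition seq_cons {T : Type} (a : T) (x : nat -> T) : nat -> T :=
  fun n => if n is k.+1 then x k else a.

Definition seq_subst {T : Type} (x : nat -> T) (n : nat) (a : T) : nat -> T :=
  fun k => if k == n then a else x k.

Definition holder {R : realType} (X : metricType R) (alpha : R) (B : X -> R) :=
  exists C : R, forall x y : X, `|B x - B y| <= C * mdist x y `^ alpha.

Section maximizing.
Context {R : realType} {X : ptopologicalType}.

Definition borel : Type := g_sigma_algebraType (@open X).

HB.instance Definition _ := Measurable.on borel.

Definition invariant_measure (T : X -> X) (mu : probability borel R) :=
  forall E : set borel, measurable E -> mu (T @^-1` E) = mu E.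

(* For bounded continuous B, the set of integrals is nonempty and bounded in
   the cases of interest, so that the real-valued [sup] is the supremum. *)
Definition max_value (T : X -> X) (B : X -> R) : R :=
  sup [set (\int[mu]_x B x) | mu in [set mu : probability borel R |
    invariant_measure T mu]].

Definition maximizing (T : X -> X) (B : X -> R) (mu : probability borel R) :=
  invariant_measure T mu /\ \int[mu]_x B x = max_value T B.

Definition msupport (mu : probability borel R) : set X :=
  [set x | forall U : set X, open U -> U x -> (0 < mu U)%E].

End maximizing.
Arguments borel : clear implicits.
Arguments max_value {R} X T B.
Arguments maximizing {R} X T B mu.

Section ruelle.
Context {R : realType}.

Definition ruelle (f : R -> R) (A phi : RN R -> R) (x : RN R) : R :=
  \int[lebesgue_measure]_a (expR (A (seq_cons a x)) * phi (seq_cons a x) * f a).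

(* The main eigenvalue is singled out by its positive Hoelder eigenfunction;
   its simplicity is a consequence and is not part of the definition. *)
Definition main_eigenvalue (alpha : R) (f : R -> R) (A : RN R -> R) (l : R) :=
  0 < l /\ exists h : RN R -> R,
    [/\ holder alpha h, forall x, 0 < h x &
        forall x, ruelle f A h x = l * h x].

Definition calibrated (A V : RN R -> R) (m : R) := forall x : RN R,
  (exists a : R, A (seq_cons a x) + V (seq_cons a x) - V x = m) /\
  (forall a : R, A (seq_cons a x) + V (seq_cons a x) - V x <= m).

End ruelle.

(* Main.v *)
(* Write ax for the sequence x with a prepended, s for the shift, and work on
   sequences of extended reals. The operator
   T w (x) = max_a (A'(ax) + w(ax)) preserves the class of functions w that are
   alpha-Hoelder with a fixed constant and do not decrease when an infinite
   coordinate is replaced by z0. Iterating T from 0 grows linearly, at a rate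
   c, and the renormalized iterates yield a function W of this class with
   max_a (A'(ax) + W(ax)) - W(x) = c. The hypothesis on A' and the
   monotonicity of W in the class prevent the maximum from being attained at an
   infinite a, so W restricts to a calibrated sub-action on real sequences.

   Integrating A' + W - W o s <= c bounds the integrals of invariant measures
   by c; periodic real sequences obtained by closing up calibrated backward
   orbits show that c is m(A') = m(A). A maximizing measure does not charge the
   open set A' + W - W o s < c, which contains the sequences starting with an
   infinite coordinate; hence, by invariance, it lives on real sequences.

   For an eigenfunction h of the operator of b A, comparing the eigenvalue
   equation with the supremum and with the infimum of h exp(- b W) gives
   exp (b (c - e)) * kappa(e) <= lambda <= exp (b c), where kappa(e) > 0 does
   not depend on b. *)

Require Import Defs.
From HB Require Import structures.
From mathcomp Require Import all_boot all_order all_algebra.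
From mathcomp Require Import all_classical all_reals all_analysis.
From mathcomp Require Import measurable_realfun ring lra.
Set Implicit Arguments.
Unset Strict Implicit.
Unset Printing Implicit Defensive.
Import Order.TTheory GRing.Theory Num.Theory.
Import numFieldNormedType.Exports.
Local Open Scope classical_set_scope.
Local Open Scope ring_scope.

(** * Recursion and bounds for the arctangent metric *)

Section arctan_metric.
Context {R : realType}.

(** The weights halve from one index to the next, so the tail of the series is half the distance of
    the shifted sequences. This is why prepending a common symbol contracts distances by 1/2. *)
Lemma wdist_recl (u v : nat -> R) :
  (forall n, `|u n| <= pi / 2) -> (forall n, `|v n| <= pi / 2) ->
  wdist u v = (pi * 2)^-1 * `|u 0 - v 0|
    + 2^-1 * wdist (seq_shift u) (seq_shift v).
Proof.
move=> bu bv; rewrite /wdist.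
have cvs : cvgn (series (wdist_term (seq_shift u) (seq_shift v))).
  by apply: is_cvg_wdist => n; rewrite /seq_shift.
apply/cvg_lim => //; rewrite -cvg_shiftS.
have -> : [sequence series (wdist_term u v) n.+1]_n =
    (fun n => (pi * 2)^-1 * `|u 0 - v 0| + 2^-1 *
      series (wdist_term (seq_shift u) (seq_shift v)) n).
  apply/funext => n; rewrite /series/= big_nat_recl// mulr_sumr; congr (_ + _).
  apply: eq_bigr => i _; rewrite /wdist_term mulrA; congr (_ * _).
  by rewrite exprS mulrCA [in LHS]invfM.
by apply: cvgD; [exact: cvg_cst|apply: cvgMr].
Qed.

(** Two arctangents differ by at most pi, so the terms are dominated by the geometric series of sum
    1. *)
Lemma wdist_le1 (u v : nat -> R) :
  (forall n, `|u n| <= pi / 2) -> (forall n, `|v n| <= pi / 2) ->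
  wdist u v <= 1.
Proof.
move=> bu bv; apply: limr_le; first exact: is_cvg_wdist.
apply: nearW => n; apply: (@le_trans _ _ (1 - 2^-1 ^+ n)); last first.
  by rewrite lerBlDr lerDl exprn_ge0.
elim: n => [|n ih]; first by rewrite /series/= big_geq// expr0 subrr.
rewrite seriesSr (le_trans (lerD ih (_ : _ <= 2^-1 ^+ n.+1)))//; last first.
  by rewrite exprS; lra.
rewrite /wdist_term invfM exprVn mulrAC ler_piMl ?invr_ge0 ?exprn_ge0//.
rewrite mulrC ler_pdivrMr ?pi_gt0// mul1r.
by rewrite (le_trans (ler_normB _ _))// [leRHS]splitr lerD.
Qed.

Lemma seq_cons_eta (T : Type) (x : nat -> T) : seq_cons (x 0) (seq_shift x) = x.
Proof. by apply/funext => -[]. Qed.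

Implicit Types (x y : eRN R) (a b : \bar R).

Lemma mdist_eRNE x y :
  mdist x y = (pi * 2)^-1 * `|atane (x 0%N) - atane (y 0%N)|
    + 2^-1 * mdist (seq_shift x : eRN R) (seq_shift y).
Proof. by apply: wdist_recl => n; exact: atane_bound. Qed.

Lemma mdist_cons a b x y :
  mdist (seq_cons a x : eRN R) (seq_cons b y) =
  (pi * 2)^-1 * `|atane a - atane b| + 2^-1 * mdist x y.
Proof. exact: mdist_eRNE. Qed.

Lemma mdist_eRN_le1 x y : mdist x y <= 1.
Proof. by apply: wdist_le1 => n; exact: atane_bound. Qed.

Lemma mdist_incl (x y : RN R) : mdist (RN_incl x) (RN_incl y) = mdist x y.
Proof. by []. Qed.

Lemma mdist_RN_le1 (x y : RN R) : mdist x y <= 1.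
Proof. exact: (mdist_eRN_le1 (RN_incl x) (RN_incl y)). Qed.

Lemma RN_incl_cons (a : R) (x : RN R) :
  RN_incl (seq_cons a x) = seq_cons a%:E (RN_incl x).
Proof. by apply/funext => -[]. Qed.

Lemma mdist_shift x y :
  mdist (seq_shift x : eRN R) (seq_shift y) <= 2 * mdist x y.
Proof.
rewrite [in leRHS]mdist_eRNE mulrDr mulVKf// lerDr.
by rewrite !mulr_ge0// invr_ge0 mulr_ge0 ?pi_ge0.
Qed.

(** By induction on [n]: since pi >= 1, the first coordinate costs at most eta / 2, and the bound
    for the shifted sequences enters with factor 1/2. The term [2^-1 ^+ n] pays for all the
    remaining coordinates. *)
Lemma mdist_prefix_le (n : nat) (eta : R) x y : 0 <= eta ->
  (forall i, (i < n)%N -> `|atane (x i) - atane (y i)| <= eta) ->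
  mdist x y <= eta + 2^-1 ^+ n.
Proof.
move=> eta0; elim: n x y => [|n ih] x y xy.
  by rewrite expr0 (le_trans (mdist_eRN_le1 x y))// lerDr.
have -> : eta + 2^-1 ^+ n.+1 = 2^-1 * eta + 2^-1 * (eta + 2^-1 ^+ n).
  by rewrite exprS; lra.
rewrite mdist_eRNE lerD//; last first.
  by rewrite ler_wpM2l// ih// => i ni; exact: xy.
rewrite ler_pM ?invr_ge0 ?mulr_ge0 ?pi_ge0//; last exact: xy.
rewrite lef_pV2 ?posrE ?mulr_gt0 ?pi_gt0// ler_peMl//.
by rewrite (le_trans _ (pi_ge2 R))// ler1n.
Qed.

Lemma mdist_prefix (n : nat) x y : (forall i, (i < n)%N -> x i = y i) ->
  mdist x y <= 2^-1 ^+ n.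
Proof.
move=> xy; rewrite -[leRHS]add0r mdist_prefix_le// => i /xy ->.
by rewrite subrr normr0.
Qed.

(** The inverse of [atane] on the closed interval; it parametrizes the extended reals by a compact
    set of reals. *)
Definition atane_inv (t : R) : \bar R :=
  if t == pi / 2 then +oo%E else if t == - (pi / 2) then -oo%E else (tan t)%:E.

Lemma atane_invK (t : R) : - (pi / 2) <= t <= pi / 2 -> atane (atane_inv t) = t.
Proof.
move=> /andP[t1 t2]; rewrite /atane_inv; case: eqP => [->//|/eqP n1].
case: eqP => [->//|/eqP n2]; rewrite /= tanK// in_itv/=.
by rewrite !lt_neqAle t1 t2 n1 eq_sym n2.
Qed.

Lemma ataneK a : atane_inv (atane a) = a.
Proof.
apply: atane_inj; apply: atane_invK.
by have := atane_bound a; rewrite ler_norml.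
Qed.

End arctan_metric.

(** * Suprema of families and almost additive sequences *)

Section real_families.
Context {R : realType}.

Lemma le_sup_range (I : Type) (i0 : I) (u v : I -> R) (k : R) :
  has_ubound (range v) -> (forall i, u i <= v i + k) ->
  sup (range u) <= sup (range v) + k.
Proof.
move=> bv uv; apply: ge_sup; first by exists (u i0), i0.
by move=> _ [i _ <-]; rewrite (le_trans (uv i))// lerD2r ub_le_sup//; exists i.
Qed.

Lemma le_inf_range (I : Type) (i0 : I) (u v : I -> R) (k : R) :
  has_lbound (range u) -> (forall i, u i <= v i + k) ->
  inf (range u) <= inf (range v) + k.
Proof.
move=> bu uv; rewrite -lerBlDr; apply: lb_le_inf; first by exists (v i0), i0.
move=> _ [i _ <-]; rewrite lerBlDr (le_trans _ (uv i))// ge_inf//.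
Qed.

(** A form of Fekete's lemma. Comparing [s] at a product with its values at the two factors shows
    that every (s n - D) / n is at most every (s m + D) / m for positive indices; [c] is the
    supremum of the former. *)
Lemma almost_additive_linear (s : nat -> R) (D : R) :
  (forall n m, `|s (n + m)%N - (s n + s m)| <= D) ->
  exists c, forall n, `|s n - n%:R * c| <= D.
Proof.
move=> sD.
have D0 : 0 <= D by exact: le_trans (sD 0%N 0%N).
have mul n m : `|s (m.+1 * n)%N - m.+1%:R * s n| <= m%:R * D.
  elim: m => [|m ih]; first by rewrite mul1n !mul1r subrr normr0 mul0r.
  move: ih (sD n (m.+1 * n)%N); rewrite [in X in _ -> _ -> X]mulSn.
  rewrite -!natr1 !ler_norml => /andP[? ?] /andP[? ?]; apply/andP; split; lra.
pose E := [set (s n.+1 - D) / n.+1%:R | n in [set: nat]].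
have key n m : (s n.+1 - D) / n.+1%:R <= (s m.+1 + D) / m.+1%:R.
  rewrite ler_pdivrMr// mulrAC ler_pdivlMr//.
  move: (mul n.+1 m) (mul m.+1 n); rewrite mulnC !ler_norml -!natr1.
  by move=> /andP[? ?] /andP[? ?]; lra.
have uE m : ubound E ((s m.+1 + D) / m.+1%:R) by move=> _ [n _ <-]; exact: key.
exists (sup E) => -[|n].
  by rewrite mul0r subr0; have := sD 0%N 0%N; rewrite opprD addrA subrr sub0r normrN.
have n0 : (0 : R) < n.+1%:R by [].
rewrite ler_norml; apply/andP; split.
  rewrite lerBrDl lerBlDr mulrC -ler_pdivlMr//.
  by apply: ge_sup; [exists ((s 1%N - D) / 1%:R), 0%N|exact: uE].
rewrite lerBlDl -lerBlDr mulrC -ler_pdivrMr//.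
by apply: ub_le_sup; [exists ((s 1%N + D) / 1%:R); exact: uE|exists n].
Qed.

End real_families.

(** * Hoelder functions with an explicit constant *)

Section hoelder_functions.
Context {R : realType}.

Definition holder_with (X : metricType R) (alpha K : R) (g : X -> R) :=
  forall x y, `|g x - g y| <= K * mdist x y `^ alpha.

Lemma holder_with_unif (X : metricType R) (alpha K : R) (g : X -> R) (e : R) :
  0 < alpha -> holder_with alpha K g -> 0 < e ->
  exists2 d, 0 < d & forall x y, mdist x y < d -> `|g x - g y| < e.
Proof.
move=> a0 gK e0.
(* The constant [K] carries no sign, so it is replaced by a positive one before dividing. *)
have K0 : 0 < `|K| + 1 by rewrite ltr_wpDl.
exists ((e / (`|K| + 1)) `^ alpha^-1).
  by rewrite powR_gt0// divr_gt0.
move=> x y xy; rewrite (le_lt_trans (gK x y))//.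
have : mdist x y `^ alpha < e / (`|K| + 1).
  have E0 : 0 <= e / (`|K| + 1) by rewrite divr_ge0 ?ltW.
  move: (e / _) E0 xy => E E0 xy.
  rewrite -[ltRHS]powRr1// -(mulVf (lt0r_neq0 a0)) powRrM.
  by apply: gt0_ltr_powR; rewrite ?nnegrE ?powR_ge0 ?mdist_ge0.
rewrite ltr_pdivlMr// => h; apply: le_lt_trans h.
by rewrite mulrC ler_wpM2l ?powR_ge0// (le_trans (ler_norm _))// lerDl.
Qed.

Lemma holder_with_continuous (X : metricType R) (alpha K : R) (g : X -> R) :
  0 < alpha -> holder_with alpha K g -> continuous g.
Proof.
move=> a0 gK x; apply/cvgrPdist_lt => e e0.
have [d d0 dP] := holder_with_unif a0 gK e0.
by apply/metricType_numDomainType.nbhs_mdistP; exists d => // y; exact: dP.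
Qed.

End hoelder_functions.

(** * The max-plus transfer operator and its calibrated fixed point *)

Section max_operator.
Context {R : realType}.
Variables (alpha C z0 : R) (A' : eRN R -> R).
Hypothesis alpha_gt0 : 0 < alpha.
Hypothesis A'C : holder_with alpha C A'.
Hypothesis A'_lt : forall (x : eRN R) (n : nat),
  A' (seq_subst x n +oo%E) < A' (seq_subst x n z0%:E) /\
  A' (seq_subst x n -oo%E) < A' (seq_subst x n z0%:E).

(** Truncation makes [chart] below continuous on the whole real line, so that the extreme value
    theorem and compactness apply on the interval without a subspace topology on the parameter. *)
Let clamp (t : R) := Num.max (- (pi / 2)) (Num.min t (pi / 2)).

Let pi2 : - (pi / 2) <= pi / 2 :> R.
Proof. by rewrite (@le_trans _ _ 0)// ?oppr_le0 divr_ge0 ?pi_ge0. Qed.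

Let clamp_bnd t : - (pi / 2) <= clamp t <= pi / 2.
Proof. by rewrite /clamp le_max lexx/= ge_max pi2 ge_min lexx orbT. Qed.

Let clamp_lip t s : `|clamp t - clamp s| <= `|t - s|.
Proof.
have p2 := pi2; rewrite /clamp /Num.max /Num.min; move: (pi / 2) p2 => p p2.
have := ler_norm (t - s); have := ler_norm (s - t); rewrite (distrC s t).
move: (`|t - s|) => d ts st; rewrite ler_norml.
by case: (ltP t p) => ?; case: (ltP s p) => ?; do 2 ?[case: ltP => ?];
  apply/andP; split; lra.
Qed.

Let chart (t : R) (x : eRN R) : eRN R := seq_cons (atane_inv (clamp t)) x.

Let chart_surj (a : \bar R) (x : eRN R) : exists2 t,
  t \in `[- (pi / 2), pi / 2]%R & chart t x = seq_cons a x.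
Proof.
exists (atane a); first by rewrite in_itv/= -ler_norml atane_bound.
rewrite /chart; congr seq_cons; rewrite -[RHS]ataneK; congr atane_inv.
rewrite /clamp; have := atane_bound a; rewrite ler_norml => /andP[l u].
by rewrite min_l// max_r.
Qed.

Let chart_continuous (w : eRN R -> R) (K : R) (x : eRN R) :
  holder_with alpha K w -> continuous (fun t => w (chart t x)).
Proof.
move=> wK t; apply/cvgrPdist_lt => e e0.
have [d d0 dP] := holder_with_unif alpha_gt0 wK e0.
have d2 : 0 < d * (pi * 2) by rewrite !mulr_gt0 ?pi_gt0.
near=> s; apply: dP.
rewrite /chart mdist_cons mdistxx mulr0 addr0 mulrC ltr_pdivrMr ?mulr_gt0 ?pi_gt0//.
rewrite !atane_invK ?clamp_bnd//; apply: (le_lt_trans (clamp_lip _ _)).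
by near: s; exact: cvgr_dist_lt.
Unshelve. all: by end_near. Qed.

(** The sequences with tail [x] form the image of a compact interval under [chart], along which [w]
    is continuous. *)
Lemma max_cons_attained (w : eRN R -> R) (K : R) (x : eRN R) :
  holder_with alpha K w ->
  exists a, forall b, w (seq_cons b x) <= w (seq_cons a x).
Proof.
move=> wK.
have [t _ tmax] := EVT_max pi2 (continuous_subspaceT (@chart_continuous w K x wK)).
exists (atane_inv (clamp t)) => b.
by have [s /tmax ? <-] := chart_surj b x.
Qed.

(** The Lax-Oleinik operator of [A'], the max-plus counterpart of the Ruelle operator. The
    real-valued [sup] is a true maximum for admissible [w]. *)
Definition max_op (w : eRN R -> R) (x : eRN R) : R :=
  sup (range (fun a => A' (seq_cons a x) + w (seq_cons a x))).

Let q : R := 2^-1 `^ alpha.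

Lemma holder_cons_ratio : 0 < q < 1.
Proof.
rewrite powR_gt0//=; have : 2^-1 `^ alpha < 1 `^ alpha :> R.
  by apply: gt0_ltr_powR; rewrite ?nnegrE ?invf_lt1// ltr1n.
by rewrite powR1.
Qed.

Let q0 : 0 < q. Proof. by case/andP: holder_cons_ratio. Qed.
Let q1 : q < 1. Proof. by case/andP: holder_cons_ratio. Qed.

Let rho_cons a (x y : eRN R) :
  mdist (seq_cons a x : eRN R) (seq_cons a y) `^ alpha = q * mdist x y `^ alpha.
Proof. by rewrite mdist_cons subrr normr0 mulr0 add0r powRM// mdist_ge0. Qed.

Let rho_le1 (x y : eRN R) : mdist x y `^ alpha <= 1.
Proof.
have := mdist_eRN_le1 x y => xy1.
have := @ge0_ler_powR _ alpha (ltW alpha_gt0) (mdist x y) 1.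
by rewrite !nnegrE mdist_ge0 ler01 powR1; apply.
Qed.

Let C0 : 0 <= C.
Proof.
have := A'C (fun=> +oo%E) (fun=> -oo%E).
move=> /(le_trans (normr_ge0 _)); rewrite pmulr_lge0// powR_gt0// mdist_gt0.
by apply/eqP => /(congr1 (fun f => f 0%N)).
Qed.

(* [D] solves [q * (C + D) = D], so that the class is stable under [max_op]. *)
Let D : R := C * q / (1 - q).

(** Both clauses are one-sided inequalities, which pass to suprema and infima; exchanging [x] and
    [y] recovers the two-sided Hoelder bound. The second clause is weak because strictness would not
    survive limits; the strict inequality will come from [A'] alone. *)
Definition admissible (w : eRN R -> R) :=
  (forall x y, w x <= w y + D * mdist x y `^ alpha) /\
  (forall x n s, ~~ (s \is a fin_num) ->
    w (seq_subst x n s) <= w (seq_subst x n z0%:E)).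

Let D0 : 0 <= D.
Proof. by rewrite /D divr_ge0 ?subr_ge0 ?mulr_ge0 ?(ltW q0) ?(ltW q1). Qed.

Lemma admissible_holder w : admissible w -> holder_with alpha D w.
Proof.
move=> [wD _] x y; rewrite ler_norml; apply/andP; split.
  by have := wD y x; rewrite metric_sym => ?; lra.
by have := wD x y => ?; lra.
Qed.

Lemma admissible_osc w x y : admissible w -> w x <= w y + D.
Proof.
move=> [wD _]; rewrite (le_trans (wD x y))// lerD2l.
by rewrite ler_piMr.
Qed.

Let sum_holder w : admissible w -> holder_with alpha (C + D) (A' \+ w).
Proof.
move=> /admissible_holder wD x y /=; rewrite opprD addrACA mulrDl.
by rewrite (le_trans (ler_normD _ _))// lerD.
Qed.

Lemma max_op_attained w x : admissible w ->
  exists a, max_op w x = A' (seq_cons a x) + w (seq_cons a x).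
Proof.
move=> aw; have [a amax] := max_cons_attained x (sum_holder aw).
exists a; apply/le_anti/andP; split.
  apply: ge_sup; first by exists (A' (seq_cons a x) + w (seq_cons a x)), a.
  by move=> _ [b _ <-]; exact: amax.
apply: ub_le_sup; last by exists a.
by exists ((A' \+ w) (seq_cons a x)) => _ [b _ <-]; exact: amax.
Qed.

Lemma max_op_ge w a x : admissible w ->
  A' (seq_cons a x) + w (seq_cons a x) <= max_op w x.
Proof.
move=> aw; have [b bmax] := max_cons_attained x (sum_holder aw).
apply: ub_le_sup; last by exists a.
by exists ((A' \+ w) (seq_cons b x)) => _ [b' _ <-]; exact: bmax.
Qed.

(** The operator is monotone and commutes with the addition of constants. *)
Lemma max_op_le w v k x : admissible w -> admissible v ->
  (forall y, w y <= v y + k) -> max_op w x <= max_op v x + k.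
Proof.
move=> aw av wv; have [a ->] := max_op_attained x aw.
by have := max_op_ge a x av; have := wv (seq_cons a x); lra.
Qed.

Lemma seq_cons_subst (T : Type) (a : T) x n s :
  seq_cons a (seq_subst x n s) = seq_subst (seq_cons a x) n.+1 s.
Proof. by apply/funext => -[]. Qed.

Lemma A'_lt_infinite x n s : ~~ (s \is a fin_num) ->
  A' (seq_subst x n s) < A' (seq_subst x n z0%:E).
Proof. by have [? ?] := A'_lt x n; case: s. Qed.

(** A maximizer for one point is a competitor for the other. Prepending multiplies the Hoelder term
    by [q], and (C + D) * q = D. A substitution at coordinate n becomes one at n + 1 after
    prepending, where the hypothesis on [A'] and the second clause for [w] both apply. *)
Lemma max_op_admissible w : admissible w -> admissible (max_op w).
Proof.
move=> aw; split=> [x y|x n s sfin].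
  have [a ->] := max_op_attained x aw.
  have := sum_holder aw (seq_cons a x) (seq_cons a y).
  rewrite /= rho_cons mulrA.
  have -> : (C + D) * q = D.
    by rewrite /D; field; rewrite subr_eq0 gt_eqF.
  have := max_op_ge a y aw; rewrite ler_norml => + /andP[_].
  lra.
have [a ->] := max_op_attained (seq_subst x n s) aw.
apply: le_trans (max_op_ge a _ aw); rewrite !seq_cons_subst.
by apply: lerD; [exact/ltW/A'_lt_infinite|exact: aw.2].
Qed.

Lemma admissible0 : admissible (fun=> 0).
Proof. by split => // x y; rewrite add0r mulr_ge0// powR_ge0. Qed.

Lemma admissibleB w k : admissible w -> admissible (fun x => w x - k).
Proof.
move=> [w1 w2]; split=> [x y|x n s sfin]; last by rewrite lerD2r w2.
by rewrite addrAC lerD2r.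
Qed.

Lemma admissible_sup (I : Type) (i0 : I) (w : I -> eRN R -> R) :
  (forall i, admissible (w i)) -> (forall x, has_ubound (range (w ^~ x))) ->
  admissible (fun x => sup (range (w ^~ x))).
Proof.
move=> aw bw; split=> [x y|x n s sfin].
  by apply: (le_sup_range i0) => // i; exact: (aw i).1.
rewrite -[leRHS]addr0; apply: (le_sup_range i0) => // i; rewrite addr0.
exact: (aw i).2.
Qed.

Lemma admissible_inf (I : Type) (i0 : I) (w : I -> eRN R -> R) :
  (forall i, admissible (w i)) -> (forall x, has_lbound (range (w ^~ x))) ->
  admissible (fun x => inf (range (w ^~ x))).
Proof.
move=> aw bw; split=> [x y|x n s sfin].
  by apply: (le_inf_range i0) => // i; exact: (aw i).1.
rewrite -[leRHS]addr0; apply: (le_inf_range i0) => // i; rewrite addr0.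
exact: (aw i).2.
Qed.

Lemma iter_max_op_admissible n w : admissible w -> admissible (iter n max_op w).
Proof. by move=> aw; elim: n => // n; exact: max_op_admissible. Qed.

Lemma iter_max_op_le n w v k x : admissible w -> admissible v ->
  (forall y, w y <= v y + k) -> iter n max_op w x <= iter n max_op v x + k.
Proof.
move=> aw av wv; elim: n x => // n ih x.
by apply: max_op_le; rewrite //; exact: iter_max_op_admissible.
Qed.

(** Each iterate oscillates by at most [D], so it equals its value at [point] up to [D].
    Monotonicity then makes these values almost additive in n. *)
Lemma max_op_growth : exists c, forall n x,
  `|iter n max_op (fun=> 0) x - n%:R * c| <= D + D.
Proof.
have a0 := admissible0.
pose w n := iter n max_op (fun=> 0).
have aw n : admissible (w n) := iter_max_op_admissible n admissible0.
pose s n := w n point.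
have wsD m y : w m y <= s m + D := admissible_osc y point (aw m).
have swD m y : s m <= w m y + D := admissible_osc point y (aw m).
have sD n m : `|s (n + m)%N - (s n + s m)| <= D.
  have le1 : s (n + m)%N <= s n + (s m + D).
    rewrite /s /w iterD.
    by apply: (iter_max_op_le _ _ (aw m) a0) => y; rewrite add0r.
  have le2 : s n <= s (n + m)%N + (D - s m).
    rewrite /s /w iterD; apply: (iter_max_op_le _ _ a0 (aw m)) => y.
    by have := swD m y; rewrite /s /w; lra.
  by rewrite ler_norml; apply/andP; split; lra.
have [c sc] := almost_additive_linear sD; exists c => n x.
have := sc n; rewrite !ler_norml => /andP[? ?].
have := wsD n x; have := swD n x; rewrite -/(w n x) => ? ?.
by apply/andP; split; lra.
Qed.

(* [u n] below decreases since its first term [u 0], being a supremum over all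
   iterates, satisfies [max_op (u 0) <= u 0 + c]; its limit is calibrated by
   compactness of the extended real line (Dini). *)
Lemma calibrated_subaction : exists c W, admissible W /\
  forall x, (exists a, A' (seq_cons a x) + W (seq_cons a x) - W x = c) /\
    (forall a, A' (seq_cons a x) + W (seq_cons a x) - W x <= c).
Proof.
have a0 := admissible0.
have [c growth] := max_op_growth.
pose w n x := iter n max_op (fun=> 0) x - n%:R * c.
have aw n : admissible (w n).
  by apply: admissibleB; apply: iter_max_op_admissible; exact: admissible0.
have w_ub x : has_ubound (range (w ^~ x)).
  exists (D + D) => _ [n _ <-].
  by have := growth n x; rewrite ler_norml => /andP[].
pose u0 x := sup (range (w ^~ x)).
have au0 : admissible u0 by exact: (admissible_sup 0%N).
have w_le n x : w n x <= u0 x by apply: ub_le_sup => //; exists n.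
(* For each n, A'(ax) + w n (ax) <= w (n + 1) (x) + c, and the right side is at most u0 x + c. *)
have Tu0 x : max_op u0 x <= u0 x + c.
  have [a ->] := max_op_attained x au0.
  rewrite addrC -lerBrDr; apply: ge_sup; first by exists (w 0%N (seq_cons a x)), 0%N.
  move=> _ [n _ <-].
  have := max_op_ge a x (iter_max_op_admissible n admissible0).
  have := w_le n.+1 x; rewrite /w iterS -natr1; lra.
pose u n x := iter n max_op u0 x - n%:R * c.
have au n : admissible (u n)
  by apply: admissibleB; exact: iter_max_op_admissible.
have u_dec n x : u n.+1 x <= u n x.
  rewrite /u iterSr -natr1.
  have := @iter_max_op_le n _ _ c x (max_op_admissible au0) au0 Tu0; lra.
have u_homo n m x : (n <= m)%N -> u m x <= u n x.
  move/subnK <-; elim: (m - n)%N => // k ih.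
  by rewrite addSn (le_trans (u_dec _ _)).
have uS n x a : A' (seq_cons a x) + u n (seq_cons a x) - c <= u n.+1 x.
  rewrite /u iterS -natr1.
  have := max_op_ge a x (iter_max_op_admissible n au0); lra.
have u_lb x : has_lbound (range (u ^~ x)).
  exists (- (D + D)) => _ [n _ <-].
  have := growth n x; rewrite ler_norml => /andP[+ _].
  have : iter n max_op (fun=> 0) x <= iter n max_op u0 x + 0.
    apply: (iter_max_op_le _ _ a0 au0) => y; rewrite addr0; have := w_le 0%N y.
    by rewrite /w mul0r subr0.
  rewrite /u; lra.
pose W x := inf (range (u ^~ x)).
have aW : admissible W by exact: (admissible_inf 0%N).
have W_le n x : W x <= u n x by apply: ge_inf => //; exists n.
have sub a x : A' (seq_cons a x) + W (seq_cons a x) - c <= W x.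
  apply: lb_le_inf; first by exists (u 0%N x), 0%N.
  move=> _ [n _ <-]; apply: le_trans (u_dec n x).
  by have := uS n x a; have := W_le n (seq_cons a x); lra.
exists c, W; split => // x; split; last by move=> a; have := sub a x; lra.
have [a aE] := max_op_attained x aW; exists a.
suff : W x <= A' (seq_cons a x) + W (seq_cons a x) - c.
  by move=> h; apply/le_anti/andP; split; [have := sub a x|]; lra.
(* If the inequality fails at the maximizer, it fails for every first coordinate. Near each [t] it
   then fails with some [u N] in place of [W], and for all later indices since [u] decreases.
   Compactness gives one N for all [t], whence u (N + 1) x < W x, which is absurd. *)
rewrite leNgt; apply/negP => lt_aW.
have := @segment_compact R (- (pi / 2)) (pi / 2).
move=> /compact_near_coveringP/(_ nat \oo
  (fun n t => A' (chart t x) + u n (chart t x) - c < W x)) => /(_ _ _)[t _|N _ /(_ N)].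
- have : inf (range (u ^~ (chart t x))) < W x + c - A' (chart t x).
    have := max_op_ge (atane_inv (clamp t)) x aW.
    by rewrite aE -/(W (chart t x)) -/(chart t x); lra.
  move=> /inf_lt[|_ [N _ <-] uN]; first by exists (u 0%N (chart t x)), 0%N.
  have cN := @chart_continuous _ _ x (sum_holder (au N)).
  have : \forall s \near t, A' (chart s x) + u N (chart s x) < W x + c.
    by apply: (cvgr_lt _ (cN t)); rewrite /=; lra.
  move=> nt; exists ([set s | A' (chart s x) + u N (chart s x) < W x + c],
    [set n | (N <= n)%N]) => /=; first by split => //; exists N.
  by move=> [s n] /= [sN /(u_homo _ _ (chart s x))]; lra.
- move=> /(_ (leqnn N)) covN.
  have [b bE] := max_op_attained x (iter_max_op_admissible N au0).
  have [t t01 tb] := chart_surj b x.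
  have := covN t t01; rewrite tb.
  have := W_le N.+1 x; rewrite /u iterS bE -natr1; lra.
Qed.

End max_operator.

(** * Image probabilities and change of variables *)

Section image_probability.
Context d d' (X : measurableType d) (Y : measurableType d') {R : realType}.

Lemma image_probability (P : probability X R) (phi : X -> Y) :
  measurable_fun setT phi ->
  exists nu : probability Y R, forall E, nu E = P (phi @^-1` E).
Proof.
move=> mphi.
pose phim : {mfun X >-> Y} := HB.pack phi (isMeasurableFun.Build _ _ _ _ _ mphi).
by exists (distribution P phim).
Qed.

(** Normalizing a measure of mass one leaves it unchanged and packages it as a probability; the
    Dirac mass at [x] is the default value of [mnormalize]. *)
Lemma measure_probability (m : {measure set X -> \bar R}) (x : X) :
  m setT = 1%E -> exists P : probability X R, forall E, P E = m E.
Proof.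
move=> m1; exists (mnormalize m (\d_x : probability X R)) => E.
rewrite [LHS](_ : _ = mnormalize m (\d_x : probability X R) E)//.
by rewrite /mnormalize [in LHS]m1 onee_eq0/= invr1 mule1.
Qed.

Lemma Rintegral_image (P : probability X R) (nu : probability Y R)
    (phi : X -> Y) (g : Y -> R) :
  measurable_fun setT phi -> measurable_fun setT g ->
  (forall E, measurable E -> nu E = P (phi @^-1` E)) ->
  P.-integrable setT (EFin \o (g \o phi)) ->
  \int[nu]_y g y = \int[P]_x g (phi x).
Proof.
move=> mphi mg nuE gi; rewrite /Rintegral; congr fine.
have := @integral_pushforward _ _ _ _ _ phi mphi P setT (EFin \o g).
rewrite preimage_setT => /(_ _ gi measurableT) <-; last exact/measurable_EFinP.
by apply: eq_measure_integral => E mE _; exact: nuE.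
Qed.

Lemma integrable_bounded (P : probability X R) (g : X -> R) (M : R) :
  measurable_fun setT g -> (forall x, `|g x| <= M) ->
  P.-integrable setT (EFin \o g).
Proof.
move=> mg gM; apply: measurable_bounded_integrable => //.
  by apply: (le_lt_trans (probability_le1 P measurableT)); rewrite ltry.
exists M; split; first exact: num_real.
by move=> k Mk x _; exact: le_trans (gM x) (ltW Mk).
Qed.

End image_probability.

(** * Borel measurability of continuous maps *)

Section borel_measurability.
Context {R : realType}.

Lemma open_borel (X : ptopologicalType) (U : set X) :
  open U -> measurable (U : set (borel X)).
Proof. by move=> oU; exact: sub_sigma_algebra. Qed.

Lemma measurable_borel d (Z : measurableType d) (Y : ptopologicalType)
    (phi : Z -> borel Y) :
  (forall U : set Y, open U -> measurable (phi @^-1` U)) ->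
  measurable_fun setT phi.
Proof.
move=> h; apply: (@measurability _ _ Z (borel Y) setT phi (@open Y)) => //.
by move=> _ [U oU <-]; rewrite setTI; exact: h.
Qed.

Lemma continuous_borel (X Y : ptopologicalType) (phi : X -> Y) :
  continuous phi -> measurable_fun setT (phi : borel X -> borel Y).
Proof.
move=> /continuousP cphi; apply: measurable_borel => U /cphi.
exact: open_borel.
Qed.

Lemma continuous_borel_real (X : ptopologicalType) (g : X -> R) :
  continuous g -> measurable_fun setT (g : borel X -> R).
Proof.
move=> /continuousP cg; apply: (measurability _ (RGenOpens.measurableE R)).
move=> _ [_ [a [b ->]] <-]; rewrite setTI; apply: open_borel; apply: cg.
exact: interval_open.
Qed.

End borel_measurability.

(** * Sub-actions, invariant measures and periodic orbits *)

Section optimization.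
Context {R : realType} {X : ptopologicalType}.
Variables (T : X -> X) (B W : X -> R) (c M : R).
Hypothesis T_cont : continuous T.
Hypothesis B_cont : continuous B.
Hypothesis W_cont : continuous W.
Hypothesis B_bnd : forall x, `|B x| <= M.
Hypothesis W_bnd : forall x, `|W x| <= M.
Hypothesis subaction : forall x, B x + W x - W (T x) <= c.

Let mT : measurable_fun setT (T : borel X -> borel X).
Proof. exact: continuous_borel. Qed.

Let mB : measurable_fun setT (B : borel X -> R).
Proof. exact: continuous_borel_real. Qed.

Let mW : measurable_fun setT (W : borel X -> R).
Proof. exact: continuous_borel_real. Qed.

Let mWT : measurable_fun setT (W \o T : borel X -> R).
Proof. exact: (measurableT_comp mW mT). Qed.

Section invariant.
Variable mu : probability (borel X) R.
Hypothesis mu_inv : invariant_measure T mu.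

Let iB : mu.-integrable setT (EFin \o B) := integrable_bounded mu mB B_bnd.
Let iW : mu.-integrable setT (EFin \o W) := integrable_bounded mu mW W_bnd.
Let iWT : mu.-integrable setT (EFin \o (W \o T)) :=
  integrable_bounded mu mWT (fun x => W_bnd (T x)).
Let iBW : mu.-integrable setT (EFin \o (fun x => B x + W x)).
Proof. exact: (integrableD measurableT iB iW). Qed.
Let iG : mu.-integrable setT (EFin \o (fun x => B x + W x - W (T x))).
Proof. exact: (integrableB measurableT iBW iWT). Qed.

(** Invariance gives [W] and [W \o T] the same finite integral. *)
Lemma Rintegral_coboundary :
  \int[mu]_x (B x + W x - W (T x)) = \int[mu]_x B x.
Proof.
rewrite (RintegralB measurableT iBW iWT) (RintegralD measurableT iB iW).
rewrite -(@Rintegral_image _ _ _ _ _ mu mu T W) ?addrK//.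
by move=> E mE; exact/esym/mu_inv.
Qed.

Lemma Rintegral_le_subaction : \int[mu]_x B x <= c.
Proof.
have icst : mu.-integrable setT (EFin \o (fun=> c)).
  exact: finite_measure_integrable_cst.
rewrite -Rintegral_coboundary.
rewrite (le_trans (le_Rintegral measurableT iG icst (fun x _ => subaction x)))//.
by rewrite Rintegral_cst//= probability_setT/= mulr1.
Qed.

(** The nonnegative function c - (B + W - W o T) has integral zero, hence vanishes almost
    everywhere. *)
Lemma maximizing_calibrated : \int[mu]_x B x = c ->
  mu [set x | B x + W x - W (T x) < c] = 0%E.
Proof.
move=> Bc.
have icst : mu.-integrable setT (EFin \o (fun=> c)).
  exact: finite_measure_integrable_cst.
pose g (x : borel X) := c - (B x + W x - W (T x)).
have g0 x : 0 <= g x by rewrite subr_ge0.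
have ig : mu.-integrable setT (EFin \o g) by exact: (integrableB measurableT icst iG).
have mg : measurable_fun setT (EFin \o g) := measurable_int _ ig.
have : (\int[mu]_x `|(EFin \o g) x| = 0)%E.
  under eq_integral do rewrite /= ger0_norm//.
  rewrite -[LHS]fineK; last exact: integrable_fin_num.
  congr EFin; transitivity (\int[mu]_x g x) => //.
  rewrite (RintegralB measurableT icst iG) Rintegral_coboundary Bc.
  by rewrite Rintegral_cst//= probability_setT/= mulr1 subrr.
move=> /(ae_eq_integral_abs _ measurableT mg)[N [mN N0 sub]].
apply: (subset_measure0 _ mN _ N0) => [|x /= lt_c].
  apply: open_borel; apply: (@open_comp _ _ _ [set r | r < c]); last exact: open_lt.
  move=> x _; apply: cvgB; first by apply: cvgD; [exact: B_cont|exact: W_cont].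
  by apply: continuous_comp; [exact: T_cont|exact: W_cont].
by apply: sub => /= /(_ I)[] /eqP; rewrite subr_eq0 => /eqP; apply/eqP; rewrite gt_eqF.
Qed.

End invariant.

(** The measure is uniform on the orbit, counted with multiplicity; taking preimages under [T]
    permutes its atoms cyclically. *)
Lemma periodic_orbit_measure (z : X) (n : nat) : iter n.+1 T z = z ->
  exists mu : probability (borel X) R, invariant_measure T mu /\
    \int[mu]_x B x = n.+1%:R^-1 * \sum_(i < n.+1) B (iter i T z).
Proof.
move=> zn.
pose del (i : nat) : {measure set (borel X) -> \bar R} :=
  \d_(iter i T z : borel X).
have k0 : 0 <= n.+1%:R^-1 :> R by rewrite invr_ge0.
pose m : {measure set (borel X) -> \bar R} := mscale (NngNum k0) (msum del n.+1).
have mE E : m E = (n.+1%:R^-1 * \sum_(i < n.+1) \1_E (iter i T z))%:E.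
  by rewrite [LHS](_ : _ = n.+1%:R^-1%:E * \sum_(i < n.+1) del i E)%E// EFinM -sumEFin.
have m1 : m setT = 1%E.
  rewrite mE; under eq_bigr do rewrite indicT.
  by rewrite big_const_ord iter_addr_0 mulVf.
have [mu muE] := measure_probability (z : borel X) m1.
exists mu; split=> [E mE'|].
  rewrite !muE !mE; congr (_ * _)%:E.
  rewrite big_ord_recr big_ord_recl/= addrC; congr (_ + _).
  by rewrite !indicE -[in RHS]zn.
(* Adding [M] makes the integrand nonnegative, as the formulas for scaled and summed measures
   require; [M] is subtracted at the end. *)
pose g (x : borel X) := B x + M.
have mg : measurable_fun setT g by exact: measurable_funD.
have g0 x : 0 <= g x.
  by rewrite -lerBlDr sub0r; have := B_bnd x; rewrite ler_norml => /andP[].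
have iB := integrable_bounded mu mB B_bnd.
have icst := finite_measure_integrable_cst mu M measurableT.
have -> : \int[mu]_x B x = \int[mu]_x g x - M.
  rewrite (RintegralD measurableT iB icst) Rintegral_cst//=.
  by rewrite probability_setT/= mulr1 addrK.
have -> : \int[mu]_x g x = n.+1%:R^-1 * \sum_(i < n.+1) g (iter i T z).
  rewrite /Rintegral (eq_measure_integral m) => [|E _ _]; last exact: muE.
  have mg' : measurable_fun setT (fun x : borel X => (g x)%:E).
    exact/measurable_EFinP.
  have g0' (x : borel X) : setT x -> (0 <= (g x)%:E)%E by rewrite lee_fin.
  rewrite (ge0_integral_mscale _ _ _ mg' g0')//.
  rewrite (ge0_integral_measure_sum _ measurableT g0' mg').
  have delE i : (\int[del i]_x (g x)%:E = (g (iter i T z))%:E)%E.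
    by rewrite (integral_dirac _ _ mg')// diracT mul1e.
  under eq_bigr do rewrite delE.
  by rewrite sumEFin.
rewrite big_split/= big_const_ord iter_addr_0 mulrDr -[M *+ _]mulr_natl mulKf//.
by rewrite addrK.
Qed.

(** The sub-action bounds all integrals by [c], and the measures on the given periodic orbits come
    arbitrarily close to it. *)
Lemma max_value_subaction :
  (forall e, 0 < e -> exists n z, iter n.+1 T z = z /\
    c - e <= n.+1%:R^-1 * \sum_(i < n.+1) B (iter i T z)) ->
  max_value X T B = c.
Proof.
move=> approx; rewrite /max_value; set E := [set _ | _ in _].
have uE : ubound E c by move=> _ [mu muT <-]; exact: Rintegral_le_subaction.
have E_ge e : 0 < e -> exists2 r, E r & c - e <= r.
  move=> /approx[n [z [zn ce]]]; have [mu [muT muB]] := periodic_orbit_measure zn.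
  by exists (\int[mu]_x B x); [exists mu|rewrite muB].
apply/le_anti/andP; split.
  by apply: ge_sup => //; have [r Er _] := E_ge 1 ltr01; exists r.
apply/ler_addgt0Pr => e /E_ge[r Er cer]; rewrite -lerBlDr (le_trans cer)//.
by apply: ub_le_sup => //; exists c.
Qed.

End optimization.

(** * Continuity of the shift and of the inclusion *)

Section shift_space.
Context {R : realType}.

Lemma iter_shiftE (T : Type) (x : nat -> T) n i :
  iter n seq_shift x i = x (i + n)%N.
Proof. by elim: n i => [|n ih] i; rewrite ?addn0//= /seq_shift ih addSnnS. Qed.

Lemma RN_incl_iter_shift (x : RN R) n :
  RN_incl (iter n seq_shift x) = iter n seq_shift (RN_incl x).
Proof. by apply/funext => i; rewrite /RN_incl !iter_shiftE. Qed.

Lemma lipschitz_continuous_metric (X Y : metricType R) (k : R) (phi : X -> Y) :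
  0 < k -> (forall x y, mdist (phi x) (phi y) <= k * mdist x y) ->
  continuous phi.
Proof.
move=> k0 phik x; apply/metricType_numDomainType.cvgrPdist_lt => e e0.
apply/metricType_numDomainType.nbhs_mdistP; exists (e / k) => /=.
  by rewrite divr_gt0.
move=> y xy; rewrite (le_lt_trans (phik _ _))//.
by rewrite mulrC -ltr_pdivlMr.
Qed.

Lemma eRN_shift_continuous : continuous (seq_shift : eRN R -> eRN R).
Proof. by apply: (@lipschitz_continuous_metric _ _ 2) => // x y; exact: mdist_shift. Qed.

Lemma RN_shift_continuous : continuous (seq_shift : RN R -> RN R).
Proof.
apply: (@lipschitz_continuous_metric _ _ 2) => // x y.
exact: (mdist_shift (RN_incl x) (RN_incl y)).
Qed.

Lemma RN_incl_continuous : continuous (@RN_incl R).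
Proof. by apply: (@lipschitz_continuous_metric _ _ 1) => // x y; rewrite mul1r. Qed.

Lemma mdist_powR_le (alpha : R) (n : nat) (x y : eRN R) : 0 < alpha ->
  (forall i, (i < n)%N -> x i = y i) ->
  mdist x y `^ alpha <= (2^-1 `^ alpha) ^+ n.
Proof.
move=> a0 xy.
have := @ge0_ler_powR _ alpha (ltW a0) (mdist x y) (2^-1 ^+ n).
rewrite !nnegrE mdist_ge0 exprn_ge0// => /(_ isT isT (mdist_prefix xy)).
by rewrite -[2^-1 ^+ n]powR_mulrn// -powRAC powR_mulrn ?powR_ge0.
Qed.

Lemma holder_with_bounded (X : metricType R) (p : X) (alpha K : R) (w : X -> R) :
  0 < alpha -> (forall x y : X, mdist x y <= 1) ->
  holder_with alpha K w -> exists M, forall x, `|w x| <= M.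
Proof.
move=> a0 diam wK; exists (`|w p| + `|K|) => x.
rewrite -[w x](subrK (w p)) addrC (le_trans (ler_normD _ _))// lerD2l.
rewrite (le_trans (wK _ _))// (le_trans (ler_wpM2r (powR_ge0 _ _) (ler_norm K)))//.
rewrite ler_piMr//.
have := @ge0_ler_powR _ alpha (ltW a0) (mdist x p) 1.
by rewrite !nnegrE mdist_ge0 ler01 powR1; apply.
Qed.

End shift_space.

(** * Periodic real sequences with nearly optimal averages *)

Section periodic_points.
Context {R : realType}.
Variables (alpha C c : R) (A' W : eRN R -> R).
Hypothesis alpha_gt0 : 0 < alpha.
Hypothesis A'C : holder_with alpha C A'.
Variable M : R.
Hypothesis W_bnd : forall x, `|W x| <= M.
Hypothesis calibrated_real : forall x : RN R, exists a : R,
  A' (seq_cons a%:E (RN_incl x)) + W (seq_cons a%:E (RN_incl x))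
    - W (RN_incl x) = c.

(* Closing up a backward orbit realizing the calibration gives a periodic
   orbit whose Birkhoff sums differ from those of the orbit by a geometric
   series. *)
Lemma periodic_approximation e : 0 < e ->
  exists n (z : RN R), iter n.+1 seq_shift z = z /\
    c - e <= n.+1%:R^-1 * \sum_(i < n.+1) A' (RN_incl (iter i seq_shift z)).
Proof.
move=> e0; have [g gP] := choice calibrated_real.
(* The backward orbit of the zero sequence: each [y n.+1] prepends a calibrating symbol to [y n], so
   the Birkhoff sums of [A'] along it telescope. *)
pose y n : RN R := iter n (fun x => seq_cons (g x) x) (fun=> 0).
have y_shift n i : (i <= n)%N -> iter i seq_shift (y n) = y (n - i)%N.
  elim: i n => [|i ih] [|n]//; rewrite ltnS => ni.
  by rewrite iterSr subSS -ih//.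
have y_sum n : \sum_(i < n) A' (RN_incl (y i.+1)) =
    n%:R * c + W (RN_incl (y 0%N)) - W (RN_incl (y n)).
  elim: n => [|n ih]; first by rewrite big_ord0 mul0r add0r subrr.
  rewrite big_ord_recr/= ih -natr1; have := gP (y n).
  by rewrite RN_incl_cons; lra.
have /andP[q0 q1] := holder_cons_ratio alpha_gt0.
set q := 2^-1 `^ alpha in q0 q1.
(* [K] bounds the total error uniformly in n: the oscillation of [W] plus the geometric series.
   Division by n + 1 > K / e brings it below [e]. *)
pose K := M + M + `|C| / (1 - q).
have geo n : \sum_(i < n) q ^+ i.+1 <= (1 - q)^-1.
  rewrite -[leRHS]mul1r ler_pdivlMr ?subr_gt0//.
  under eq_bigr do rewrite exprS.
  rewrite -mulr_sumr -mulrA [_ * (1 - q)]mulrC -opprB mulNr -subrX1 opprB.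
  rewrite (@le_trans _ _ (q * 1))//; last by rewrite mulr1 ltW.
  by rewrite ler_wpM2l ?(ltW q0)// gerBl exprn_ge0 ?(ltW q0).
pose n := Num.truncn (K / e).
have nK : K / e < n.+1%:R.
  by rewrite truncnS_gt.
pose z : RN R := fun i => y n.+1 (i %% n.+1)%N.
exists n, z; split.
  by apply/funext => i; rewrite iter_shiftE /z modnDr.
rewrite mulrC ler_pdivlMr//.
have near_orbit (i : 'I_n.+1) :
    A' (RN_incl (y (n.+1 - i)%N)) - `|C| * q ^+ (n.+1 - i) <=
    A' (RN_incl (iter i seq_shift z)).
  have := A'C (RN_incl (y (n.+1 - i)%N)) (RN_incl (iter i seq_shift z)).
  set r := _ `^ alpha => h.
  (* After i shifts, the periodic sequence and the orbit still agree on the n + 1 - i coordinates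
     before the first repetition. *)
  have rq : r <= q ^+ (n.+1 - i).
    rewrite /r; apply: mdist_powR_le => // j jn.
    rewrite /RN_incl -y_shift; last exact: ltnW.
    by rewrite !iter_shiftE /z modn_small// addnC -ltn_subRL.
  have : C * r <= `|C| * q ^+ (n.+1 - i).
    by rewrite (le_trans (ler_wpM2r (powR_ge0 _ _) (ler_norm C)))// ler_wpM2l.
  move: h; rewrite ler_norml => /andP[_ h1] h2.
  by rewrite lerBlDr -lerBlDl (le_trans h1).
have : \sum_(i < n.+1) (A' (RN_incl (y (n.+1 - i)%N)) - `|C| * q ^+ (n.+1 - i)) <=
    \sum_(i < n.+1) A' (RN_incl (iter i seq_shift z)) by exact: ler_sum.
rewrite sumrB -mulr_sumr.
rewrite (reindex_inj rev_ord_inj)/= [X in _ - _ * X](reindex_inj rev_ord_inj)/=.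
under eq_bigr => i _ do rewrite subKn//.
under [X in _ - _ * X]eq_bigr => i _ do rewrite subKn//.
rewrite y_sum; apply: le_trans.
have := ler_wpM2l (normr_ge0 C) (geo n.+1).
have := W_bnd (RN_incl (y 0%N)); have := W_bnd (RN_incl (y n.+1)).
rewrite !ler_norml => /andP[_ +] /andP[+ _].
have : K < e * n.+1%:R by rewrite -ltr_pdivrMl// mulrC.
rewrite /K; move: (W _) (W _) (\sum_(_ < _) _) (n.+1%:R : R) => w1 w0 S N.
by lra.
Qed.

End periodic_points.

(** * Estimates on the real line *)

Section real_line.
Context {R : realType}.

Lemma atan_lipschitz (a b : R) : `|atan a - atan b| <= `|a - b|.
Proof.
wlog ab : a b / a < b.
  move=> h; have [ab|ba|->] := ltgtP a b; first exact: h.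
    by rewrite distrC [leRHS]distrC h.
  by rewrite !subrr.
have [c _ atab] := MVT ab (fun x _ => is_derive1_atan x)
  (continuous_subspaceT (fun x => @continuous_atan R x)).
rewrite distrC [leRHS]distrC atab normrM ler_piMl//.
have c1 : 1 <= 1 + c ^+ 2 by rewrite lerDl sqr_ge0.
by rewrite ger0_norm ?invr_ge0 ?(le_trans _ c1)// invf_le1// (lt_le_trans _ c1).
Qed.

Lemma continuous_gt0_min (f : R -> R) (a b : R) : a <= b ->
  continuous f -> (forall x, 0 < f x) ->
  exists2 k, 0 < k & forall x, a <= x <= b -> k <= f x.
Proof.
move=> ab cf f0; have [c _ cmin] := EVT_min ab (continuous_subspaceT cf).
by exists (f c) => // x xab; apply: cmin; rewrite in_itv.
Qed.

Lemma Rintegral_ge_itv (F : R -> R) (u d k : R) :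
  lebesgue_measure.-integrable setT (EFin \o F) ->
  (forall a, 0 <= F a) -> 0 < d -> 0 <= k ->
  (forall a, u <= a <= u + d -> k <= F a) ->
  k * d <= \int[lebesgue_measure]_a F a.
Proof.
move=> iF F0 d0 k0 kF.
have mF := measurable_int _ iF.
rewrite -lee_fin /Rintegral fineK; last exact: integrable_fin_num.

apply: (@le_trans _ _ (\int[lebesgue_measure]_(a in `[u, (u + d)%R]) (F a)%:E)%E).
  have -> : (k * d)%:E = (\int[lebesgue_measure]_(a in `[u, (u + d)%R]) k%:E)%E.
    rewrite integral_cst//= lebesgue_measure_itv/= lte_fin ltrDl d0.
    by rewrite -EFinB addrAC subrr add0r EFinM.
  by apply: ge0_le_integral => //=; exact: measurable_funS mF.
apply: ge0_subset_integral => //= a _.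
by rewrite lee_fin.
Qed.

Lemma integrable_mul_bounded (f g : R -> R) (M : R) :
  lebesgue_measure.-integrable setT (EFin \o f) ->
  continuous g -> (forall a, `|g a| <= M) ->
  lebesgue_measure.-integrable setT (EFin \o (fun a => g a * f a)).
Proof.
move=> fi cg gM; have mf := measurable_int _ fi.
apply: (le_integrable measurableT _ _ (integrableZl measurableT M fi)).
  apply/measurable_EFinP; apply: measurable_funM.
    exact: continuous_measurable_fun.
  exact/measurable_EFinP.
move=> a _; rewrite /= lee_fin !normrM ler_wpM2r//.
by rewrite (le_trans (gM a))// ler_norm.
Qed.

End real_line.

(** * Two-sided bounds for the main eigenvalue *)

Section ruelle_eigenvalue.
Context {R : realType}.
Variables (alpha C K l : R) (f : R -> R) (A h : RN R -> R).
Hypothesis alpha_gt0 : 0 < alpha.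
Hypothesis f_gt0 : forall a, 0 < f a.
Hypothesis f_cont : continuous f.
Hypothesis f_int1 : (\int[lebesgue_measure]_a (f a)%:E = 1)%E.
Hypothesis AC : holder_with alpha C A.
Hypothesis hK : holder_with alpha K h.
Hypothesis h_gt0 : forall x, 0 < h x.
Hypothesis l_gt0 : 0 < l.
Hypothesis eigen : forall x, ruelle f A h x = l * h x.

Lemma mdist_RN_cons (a b : R) (x y : RN R) :
  mdist (seq_cons a x : RN R) (seq_cons b y) =
  (pi * 2)^-1 * `|atan a - atan b| + 2^-1 * mdist x y.
Proof. by rewrite -mdist_incl !RN_incl_cons mdist_cons. Qed.

Lemma holder_cons_continuous (k : R) (g : RN R -> R) (x : RN R) :
  holder_with alpha k g -> continuous (fun a => g (seq_cons a x)).
Proof.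
move=> gk a; apply/cvgrPdist_lt => e e0.
have [d d0 dP] := holder_with_unif alpha_gt0 gk e0.
have d2 : 0 < d * (pi * 2) by rewrite !mulr_gt0 ?pi_gt0.
near=> b; apply: dP.
rewrite mdist_RN_cons mdistxx mulr0 addr0 mulrC ltr_pdivrMr ?mulr_gt0 ?pi_gt0//.
apply: (le_lt_trans (atan_lipschitz _ _)).
by near: b; exact: cvgr_dist_lt.
Unshelve. all: by end_near. Qed.

Lemma density_integrable : lebesgue_measure.-integrable setT (EFin \o f).
Proof.
apply/integrableP; split.
  by apply/measurable_EFinP; exact: continuous_measurable_fun.
under eq_integral do rewrite /= ger0_norm ?ltW//.
by rewrite f_int1 ltry.
Qed.

Let bounded (k : R) (g : RN R -> R) : holder_with alpha k g ->
  exists M, forall x, `|g x| <= M.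
Proof.
move=> gk; apply: (holder_with_bounded (point : RN R) alpha_gt0 _ gk).
exact: mdist_RN_le1.
Qed.

Let kernel x a := expR (A (seq_cons a x)) * h (seq_cons a x) * f a.

Let kernel_ge0 x a : 0 <= kernel x a.
Proof. by rewrite !mulr_ge0 ?expR_ge0 ?ltW. Qed.

Let kernel_integrable x :
  lebesgue_measure.-integrable setT (EFin \o kernel x).
Proof.
have [MA AM] := bounded AC; have [Mh hM] := bounded hK.
apply: (integrable_mul_bounded (M := expR MA * Mh) density_integrable).
  move=> a; apply: cvgM; last exact: (holder_cons_continuous hK).
  apply: continuous_comp; last exact: continuous_expR.
  exact: (holder_cons_continuous AC).
move=> a; rewrite normrM ler_pM// ger0_norm ?expR_ge0// ler_expR.
exact: le_trans (ler_norm _) (AM _).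
Qed.

Let eigenE x : l * h x = \int[lebesgue_measure]_a kernel x a.
Proof. by rewrite -eigen. Qed.

(* A positive lower bound of [h] on the cylinder of the points with k + 1
   coordinates in [-eta, eta] gives one on the cylinder with k coordinates,
   as [l * h x] is an average over the preimages of [x]. *)
Lemma eigenfunction_lower_bound : exists2 k, 0 < k & forall x, k <= h x.
Proof.
have [MA AM] := bounded AC.
pose p : RN R := fun=> 0.
have h02 : 0 < h p / 2 by rewrite divr_gt0.
have [d d0 dP] := holder_with_unif alpha_gt0 hK h02.
pose eta := d / 2; have eta0 : 0 < eta by rewrite divr_gt0.
(* If the first N coordinates lie in [-eta, eta], the distance to the zero sequence is below eta +
   eta = d, so [h] exceeds half its value there. *)
have [N Nd] : exists N, 2^-1 ^+ N < eta :> R.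
  have := @cvg_expr R 2^-1; rewrite ger0_norm// => /(_ _)/cvgr0Pnorm_lt.
  move=> /(_ _ eta eta0)[|N _ /(_ N (leqnn N))]; first by rewrite invf_lt1// ltr1n.
  by move=> ?; exists N; rewrite (le_lt_trans (ler_norm _)).
have [k0 k00 fk0] := continuous_gt0_min (ltW eta0) f_cont f_gt0.
(* Here n counts the coordinates already freed; at n = N no constraint is left. *)
suff cyl n : (n <= N)%N -> exists2 k, 0 < k &
    forall x, (forall i, (i < N - n)%N -> `|x i| <= eta) -> k <= h x.
  have [k kp kh] := cyl N (leqnn N); exists k => // x.
  by apply: kh => i; rewrite subnn.
elim: n => [_|n ih nN].
  exists (h p / 2) => // x; rewrite subn0 => xeta.
  have /dP : mdist p x < d.
    rewrite -mdist_incl (le_lt_trans (mdist_prefix_le (n := N) (ltW eta0) _))//.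
      move=> i iN; rewrite /RN_incl/= (le_trans (atan_lipschitz _ _))//.
      by rewrite sub0r normrN; exact: xeta.
    by rewrite [ltRHS]splitr ltrD2l.
  by rewrite ltr_norml => /andP[_]; lra.
have [k kp kh] := ih (ltnW nN).
(* The factors bound below the weight, [h], the density and the length of the interval [0, eta] to
   which the eigenvalue integral is restricted. *)
exists (expR (- MA) * k * k0 * eta / l).
  by rewrite !(divr_gt0, mulr_gt0) ?expR_gt0.
move=> x xeta; rewrite ler_pdivrMr// [leRHS]mulrC eigenE.
apply: (@Rintegral_ge_itv _ _ 0) => //.
  by rewrite !mulr_ge0 ?expR_ge0// ltW.
move=> a; rewrite add0r => aeta.
rewrite ler_pM ?mulr_ge0 ?expR_ge0 ?(ltW kp) ?(ltW k00) ?fk0//.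
rewrite ler_pM ?expR_ge0 ?(ltW kp)//.
  by rewrite ler_expR; have := AM (seq_cons a x); rewrite ler_norml => /andP[].
apply: kh => -[_|i] /=; first by case/andP: aeta => a0 aeta; rewrite ger0_norm.
by move=> iN; apply: xeta; rewrite subnS ltn_predRL.
Qed.

Variables (V : RN R -> R) (c M : R).
Hypothesis V_bnd : forall x, `|V x| <= M.

(** Conjugation by exp V replaces the exponent A(ax) by A(ax) + V(ax) - V(x), which the sub-action
    controls. *)
Let g x := h x * expR (- V x).

Let g_gt0 x : 0 < g x. Proof. by rewrite mulr_gt0 ?expR_gt0. Qed.

Let kernelE x a : kernel x a =
  expR (A (seq_cons a x) + V (seq_cons a x)) * g (seq_cons a x) * f a.
Proof.
by rewrite /kernel /g expRD expRN; field; rewrite gt_eqF ?expR_gt0.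
Qed.

Let eigen_g x : l * g x = expR (- V x) * \int[lebesgue_measure]_a kernel x a.
Proof. by rewrite /g mulrA eigenE mulrC. Qed.

(** With H the supremum of [g], the eigenvalue equation gives l * g x <= exp c * H because [f] has
    integral 1; then take the supremum over x and divide by H. *)
Lemma eigenvalue_le :
  (forall x a, A (seq_cons a x) + V (seq_cons a x) - V x <= c) -> l <= expR c.
Proof.
move=> sub; have [Mh hM] := bounded hK.
have g_ub : has_ubound (range g).
  exists (Mh * expR M) => _ [x _ <-]; rewrite ler_pM ?expR_ge0 ?(ltW (h_gt0 x))//.
    exact: le_trans (ler_norm _) (hM x).
  by rewrite ler_expR; have := V_bnd x; rewrite ler_norml; lra.
pose H := sup (range g).
have gH x : g x <= H by apply: ub_le_sup => //; exists x.
have H0 : 0 < H by rewrite (lt_le_trans (g_gt0 point)).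
have lg x : l * g x <= expR c * H.
  rewrite eigen_g expRN mulrC ler_pdivrMr ?expR_gt0// mulrAC -expRD.
  have -> : expR (c + V x) * H =
      \int[lebesgue_measure]_a (expR (c + V x) * H * f a).
    rewrite RintegralZl//; last exact: density_integrable.
    by rewrite /Rintegral f_int1 mulr1.
  apply: le_Rintegral => //.
    exact: (integrableZl measurableT (expR (c + V x) * H) density_integrable).
  move=> a _; rewrite kernelE ler_wpM2r ?(ltW (f_gt0 _))//.
  rewrite ler_pM ?expR_ge0 ?(ltW (g_gt0 _))//.
  by rewrite ler_expR; have := sub x a; lra.
rewrite -(ler_pM2r H0) -ler_pdivlMl//; apply: ge_sup.
  by exists (g point), point.
by move=> _ [x _ <-]; rewrite ler_pdivlMl.
Qed.

(** Dual to the upper bound, with the infimum of [g], which is positive by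
    [eigenfunction_lower_bound]; the integral is restricted to the interval of length [d] provided
    for each x. *)
Lemma eigenvalue_ge (e d k : R) : 0 < d -> 0 < k ->
  (forall x, exists u, forall a, u <= a <= u + d ->
    e <= A (seq_cons a x) + V (seq_cons a x) - V x /\ k <= f a) ->
  expR e * (k * d) <= l.
Proof.
move=> d0 k0 near_max; have [kh kh0 hkh] := eigenfunction_lower_bound.
have g_lb x : kh * expR (- M) <= g x.
  rewrite ler_pM ?expR_ge0 ?(ltW kh0)// ler_expR lerN2.
  exact: le_trans (ler_norm _) (V_bnd x).
pose m := inf (range g).
have mg x : m <= g x.
  by apply: ge_inf; [exists (kh * expR (- M)) => _ [y _ <-]|exists x].
have m0 : 0 < m.
  apply: (@lt_le_trans _ _ (kh * expR (- M))); first by rewrite mulr_gt0 ?expR_gt0.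
  by apply: lb_le_inf; [exists (g point), point|move=> _ [x _ <-]].
have lg x : expR e * (k * d) * m <= l * g x.
  rewrite eigen_g expRN mulrC [leRHS]mulrC ler_pdivlMr ?expR_gt0//.
  have [u uP] := near_max x.
  have -> : m * (expR e * (k * d)) * expR (V x) =
      expR (e + V x) * m * k * d by rewrite expRD; ring.
  apply: (@Rintegral_ge_itv _ _ u) => //.
    by rewrite !mulr_ge0 ?expR_ge0// ltW.
  move=> a /uP[ea ka]; rewrite kernelE.
  rewrite ler_pM ?mulr_ge0 ?expR_ge0 ?(ltW m0) ?(ltW k0)//.
  rewrite ler_pM ?expR_ge0 ?(ltW m0)// ler_expR; lra.
rewrite -(ler_pM2r m0) -ler_pdivrMl//; apply: lb_le_inf.
  by exists (g point), point.
by move=> _ [x _ <-]; rewrite ler_pdivrMl.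
Qed.

End ruelle_eigenvalue.

(** * Sequences with an infinite coordinate and the retraction onto real ones *)

Section infinite_coordinates.
Context {R : realType}.

Lemma atane_fin (a : \bar R) : (a \is a fin_num) = (`|atane a| < pi / 2).
Proof.
case: a => [a| |]; last 2 first.
- by rewrite /= ger0_norm ?ltxx// divr_ge0 ?pi_ge0.
- by rewrite /= normrN ger0_norm ?ltxx// divr_ge0 ?pi_ge0.
- by rewrite /= ltr_norml atan_gtNpi2 atan_ltpi2.
Qed.

Lemma iter_continuous (X : topologicalType) (T : X -> X) n :
  continuous T -> continuous (iter n T).
Proof.
by move=> cT; elim: n => [|n ih] x //=; apply: continuous_comp; [exact: ih|exact: cT].
Qed.

Definition infinite_at (n : nat) : set (eRN R) := [set x | x n \isn't a fin_num].

Lemma infinite_at_shift n :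
  infinite_at n = iter n seq_shift @^-1` (infinite_at 0%N).
Proof. by apply/funext => x; rewrite /infinite_at /= iter_shiftE. Qed.

Lemma closed_infinite_at n : closed (infinite_at n).
Proof.
have /continuous_closedP cphi : continuous (fun x : eRN R => `|atane (x 0%N)|).
  apply: (@lipschitz_continuous_metric _ _ R^o (pi * 2)).
    by rewrite mulr_gt0 ?pi_gt0.
  move=> x y.
  change (`| `|atane (y 0%N)| - `|atane (x 0%N)| | <= pi * 2 * mdist x y).
  rewrite distrC (le_trans (ler_dist_dist _ _))//.
  rewrite mdist_eRNE mulrDr mulVKf ?gt_eqF ?mulr_gt0 ?pi_gt0// lerDl.
  by rewrite !mulr_ge0 ?pi_ge0 ?mdist_ge0.
have /continuous_closedP cshift := @iter_continuous (eRN R) _ n (@eRN_shift_continuous R).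
rewrite infinite_at_shift; apply: cshift.
rewrite (_ : infinite_at 0%N =
    (fun x : eRN R => `|atane (x 0%N)|) @^-1` [set r | pi / 2 <= r]).
  by apply: cphi; exact: closed_ge.
by apply/funext => x; rewrite /infinite_at/= atane_fin -leNgt.
Qed.

Definition infinite_somewhere : set (eRN R) := \bigcup_n infinite_at n.

Lemma measurable_infinite_somewhere :
  measurable (infinite_somewhere : set (borel (eRN R))).
Proof.
apply: bigcup_measurable => n _; rewrite -[infinite_at n]setCK.
by apply: measurableC; apply: open_borel; exact/closed_openC/closed_infinite_at.
Qed.

(** A Borel left inverse of the inclusion, with the zero sequence as default. It carries measures on
    extended sequences to real ones. *)
Definition eRN_retract (x : eRN R) : RN R :=
  if `[< infinite_somewhere x >] then (fun=> 0) else fun n => fine (x n).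

Lemma eRN_retractK (x : eRN R) : ~ infinite_somewhere x ->
  RN_incl (eRN_retract x) = x.
Proof.
move=> xfin; rewrite /eRN_retract asboolF//; apply/funext => n.
rewrite /RN_incl fineK//; apply: contrapT => /negP xn.
by apply: xfin; exists n.
Qed.

(** The inclusion is isometric, so real sequences carry the subspace topology; the witness is the
    largest open set whose trace lies in [U]. *)
Lemma RN_incl_open (U : set (RN R)) : open U ->
  exists2 U' : set (eRN R), open U' & U = @RN_incl R @^-1` U'.
Proof.
move=> oU.
exists (\bigcup_(O in [set O | open O /\ @RN_incl R @^-1` O `<=` U]) O).
  by apply: bigcup_open => O [].
apply/seteqP; split => [x Ux|x [W [_ WU] Wx]]; last exact: WU.
have /metricType_numDomainType.nbhs_mdistP[e /= e0 eU] : nbhs x U.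
  by apply: open_nbhs_nbhs; split.
exists (ball (RN_incl x) e)°; last exact: nbhsx_ballx.
split; first exact: open_interior.
move=> y /interior_subset; rewrite ballEmdist /= mdist_incl; exact: eU.
Qed.

Lemma measurable_eRN_retract :
  measurable_fun setT (eRN_retract : borel (eRN R) -> borel (RN R)).
Proof.
apply: measurable_borel => U /RN_incl_open[U' oU' ->].
have mI := measurable_infinite_somewhere.
have -> : eRN_retract @^-1` (@RN_incl R @^-1` U') =
    (U' `\` infinite_somewhere) `|`
    (infinite_somewhere `&` [set x | U' (RN_incl (eRN_retract x))]).
  apply/seteqP; split => [x /= Ux|x /= [[Ux xfin]|[]//]]; last by rewrite eRN_retractK.
  have [xinf|xfin] := pselect (infinite_somewhere x); first by right.
  by left; rewrite eRN_retractK in Ux.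
apply: measurableU.
  by apply: measurableD => //; exact: open_borel.
have [U0|U0] := pselect (U' (RN_incl (fun=> 0))).
  rewrite (_ : _ `&` _ = infinite_somewhere)//.
  apply/seteqP; split => [x []//|x xinf]; split => //=.
  by rewrite /eRN_retract asboolT.
rewrite (_ : _ `&` _ = set0)//; apply/seteqP; split => // x [xinf] /=.
by rewrite /eRN_retract asboolT.
Qed.

Lemma eRN_retract_shift (x : eRN R) : ~ infinite_somewhere x ->
  eRN_retract (seq_shift x) = seq_shift (eRN_retract x).
Proof.
move=> xfin.
have sxfin : ~ infinite_somewhere (seq_shift x).
  by move=> [n _ xn]; apply: xfin; exists n.+1.
by rewrite /eRN_retract !asboolF.
Qed.

End infinite_coordinates.

Lemma measure_eq_off_null d (T : measurableType d) (R : realType)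
    (mu : {measure set T -> \bar R}) (N A B : set T) :
  measurable N -> measurable A -> measurable B -> mu N = 0%E ->
  (forall x, ~ N x -> A x <-> B x) -> mu A = mu B.
Proof.
move=> mN mA mB N0 AB.
have off E : measurable E -> mu E = mu (E `\` N).
  move=> mE; rewrite (measureDI mu mE mN) [X in (_ + X)%E](_ : _ = 0%E) ?adde0//.
  exact: (subset_measure0 (measurableI _ _ mE mN) mN (@subIsetr _ _ _) N0).
rewrite off// [RHS]off//; congr (mu _).
by apply/seteqP; split => x [Ex Nx]; split => //; exact/AB.
Qed.

(** * Uniform near-maximizers and the zero-temperature limit *)

Section near_maximizers.
Context {R : realType}.

(** Beyond a large N the arctangent varies by less than [d], so truncating [a] to [-N, N] is cheap
    in the metric. Maximizers may be unbounded as x varies, yet their substitutes stay in a bounded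
    region where [f] has a positive minimum. *)
Lemma atan_clamp (d : R) : 0 < d -> exists2 N, 0 <= N & forall a, exists u,
  -N <= u <= N /\ forall b, u <= b <= u + d -> `|atan a - atan b| <= d + d.
Proof.
move=> d0.
have [N [N0 Nd]] : exists N : R, 0 <= N /\ pi / 2 - d < atan N.
  have : \forall N \near +oo, (0 : R) <= N /\ pi / 2 - d < atan N.
    near=> N; split; first by near: N; exact: nbhs_pinfty_ge.
    by near: N; apply: (cvgr_gt _ (@cvgy_atan R)); rewrite ltrBlDr ltrDl.
  by move=> /filter_ex.
exists N => // a.
pose u := Num.max (- N) (Num.min a N).
have uN : - N <= u <= N.
  by rewrite /u le_max lexx/= ge_max ge_min lexx orbT andbT ge0_cp.
have au : `|atan a - atan u| <= d.
  have := atan_ltpi2 a; have := atan_gtNpi2 a; rewrite /u.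
  have [aN|Na] := leP a N; have [Na'|aN'] := leP (- N) a.
  - by rewrite subrr normr0 ltW.
  - rewrite atanN => ? ?.
    have := lt_atan aN'; rewrite atanN => ?.
    rewrite ler_norml; apply/andP; split; lra.
  - rewrite max_r ?ge0_cp// => ? ?.
    have := lt_atan Na => ?.
    rewrite ler_norml; apply/andP; split; lra.
  - by have := lt_trans Na aN'; rewrite ltrNr; lra.
exists u; split => // b /andP[ub bu].
rewrite (le_trans (ler_distD (atan u) _ _))// lerD//.
rewrite (le_trans (atan_lipschitz _ _))// distrC ger0_norm ?subr_ge0//.
by rewrite lerBlDl.
Unshelve. all: by end_near. Qed.

Variables (alpha C D c : R) (f : R -> R) (A V : RN R -> R).
Hypothesis alpha_gt0 : 0 < alpha.
Hypothesis f_gt0 : forall a, 0 < f a.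
Hypothesis f_cont : continuous f.
Hypothesis AC : holder_with alpha C A.
Hypothesis VD : holder_with alpha D V.
Hypothesis cal : calibrated A V c.

Lemma near_maximizers (e : R) : 0 < e -> exists d k, [/\ 0 < d, 0 < k &
  forall x, exists u, forall a, u <= a <= u + d ->
    c - e <= A (seq_cons a x) + V (seq_cons a x) - V x /\ k <= f a].
Proof.
move=> e0; have e2 : 0 < e / 2 by rewrite divr_gt0.
have [d1 d10 Ad1] := holder_with_unif alpha_gt0 AC e2.
have [d2 d20 Vd2] := holder_with_unif alpha_gt0 VD e2.
pose d := Num.min d1 d2; have d0 : 0 < d by rewrite lt_min d10.
have [N N0 clampN] := atan_clamp d0.
have NNd : - N <= N + d by lra.
have [k k0 fk] := continuous_gt0_min NNd f_cont f_gt0.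
exists d, k; split => // x; have [[a aE] _] := cal x.
have [u [/andP[Nu uN] uP]] := clampN a; exists u => b ubd; split; last first.
  by apply: fk; case/andP: ubd => ub bu; rewrite (le_trans Nu ub) (le_trans bu)// lerD2r.
have dist : mdist (seq_cons a x : RN R) (seq_cons b x) < d.
  rewrite mdist_RN_cons mdistxx mulr0 addr0 mulrC ltr_pdivrMr ?mulr_gt0 ?pi_gt0//.
  rewrite (le_lt_trans (uP b ubd))//.
  by have := pi_ge2 R; move: (d) d0 => r; nra.
have /Ad1 : mdist (seq_cons a x : RN R) (seq_cons b x) < d1.
  by rewrite (lt_le_trans dist)// ge_min lexx.
have /Vd2 : mdist (seq_cons a x : RN R) (seq_cons b x) < d2.
  by rewrite (lt_le_trans dist)// ge_min lexx orbT.
by rewrite !ltr_norml => /andP[_ ?] /andP[_ ?]; lra.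
Qed.

Lemma eigenvalue_asymptotics (lambda : R -> R) :
  (\int[lebesgue_measure]_a (f a)%:E = 1)%E ->
  (forall b, 0 < b -> main_eigenvalue alpha f (fun x => b * A x) (lambda b)) ->
  b^-1 * ln (lambda b) @[b --> +oo] --> c.
Proof.
move=> f1 eig.
have [M VM] : exists M, forall x, `|V x| <= M.
  apply: (holder_with_bounded (point : RN R) alpha_gt0 _ VD).
  exact: mdist_RN_le1.
have bA b : 0 < b -> holder_with alpha (b * C) (fun x => b * A x).
  move=> b0 x y; rewrite -mulrBr normrM gtr0_norm// -mulrA.
  by rewrite ler_wpM2l ?(ltW b0).
have bV b : 0 < b -> forall x, `|b * V x| <= b * M.
  by move=> b0 x; rewrite normrM gtr0_norm// ler_wpM2l ?(ltW b0).
apply/cvgrPdist_le => e e0.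
have e2 : 0 < e / 2 by rewrite divr_gt0.
(* [d] and [k] are fixed before [b], so ln (k * d) / b tends to 0 and is absorbed by the other half
   of [e]. *)
have [d [k [d0 k0 near_max]]] := near_maximizers e2.
near=> b.
have b0 : 0 < b by near: b; exact: nbhs_pinfty_gt.
have [lb0 [h [[K hK] h0 hl]]] := eig b b0.
have upper : ln (lambda b) <= b * c.
  rewrite -[leRHS]expRK ler_ln ?posrE ?expR_gt0//.
  apply: (eigenvalue_le alpha_gt0 f_gt0 f_cont f1 (bA b b0) hK h0 lb0 hl (bV b b0)).
  move=> x a; rewrite -mulrDr -mulrBr ler_wpM2l ?(ltW b0)//.
  exact: (cal x).2.
have kd0 : 0 < k * d by rewrite mulr_gt0.
have lower : b * (c - e / 2) + ln (k * d) <= ln (lambda b).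
  rewrite -[X in X + _]expRK -lnM ?posrE ?expR_gt0// ler_ln ?posrE//; last first.
    by rewrite mulr_gt0 ?expR_gt0.
  apply: (eigenvalue_ge alpha_gt0 f_gt0 f_cont f1 (bA b b0) hK h0 lb0 hl (bV b b0)) => //.
  move=> x; have [u uP] := near_max x; exists u => a /uP[? ?]; split=> //.
  by rewrite -mulrDr -mulrBr ler_wpM2l ?(ltW b0).
have big : - ln (k * d) <= b * (e / 2).
  by rewrite -ler_pdivrMr//; near: b; exact: nbhs_pinfty_ge.
rewrite ler_norml; apply/andP; split.
  rewrite lerBrDl -lerBrDr opprK ler_pdivrMl//.
  by rewrite (le_trans upper)// ler_pM2l// lerDl ltW.
rewrite lerBlDl -lerBlDr ler_pdivlMl//; lra.
Unshelve. all: by end_near. Qed.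

End near_maximizers.

(** * Maximizing measures, calibrated sub-action and eigenvalue limit *)

Theorem theorem2p6 (R : realType) (alpha : R) (alpha01 : 0 < alpha <= 1)
  (f : R -> R) (f_gt0 : forall a, 0 < f a) (f_cont : continuous f)
  (f_int1 : (\int[lebesgue_measure]_a (f a)%:E = 1)%E)
  (A : RN R -> R) (A_holder : holder alpha A)
  (A' : eRN R -> R) (A'_holder : holder alpha A')
  (A'_ext : forall x : RN R, A' (RN_incl x) = A x)
  (z0 : R)
  (A'_lt : forall (x : eRN R) (n : nat),
    A' (seq_subst x n +oo%E) < A' (seq_subst x n z0%:E) /\
    A' (seq_subst x n -oo%E) < A' (seq_subst x n z0%:E)) :
  [/\ forall mu : probability (borel (eRN R)) R,
        maximizing (eRN R) seq_shift A' mu ->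
        msupport mu `<=` range (@RN_incl R) /\
        exists nu : probability (borel (RN R)) R,
          (forall E : set (borel (eRN R)), measurable E ->
             mu E = nu (@RN_incl R @^-1` E)) /\
          maximizing (RN R) seq_shift A nu,
      exists V : RN R -> R,
        continuous V /\ calibrated A V (max_value (RN R) seq_shift A) &
      forall lambda : R -> R,
        (forall b, 0 < b ->
           main_eigenvalue alpha f (fun x => b * A x) (lambda b)) ->
        b^-1 * ln (lambda b) @[b --> +oo] --> max_value (RN R) seq_shift A].
Proof.
have a0 : 0 < alpha by case/andP: alpha01.
have [C A'C] : exists C, holder_with alpha C A' by [].
have [c [W [aW cal]]] := calibrated_subaction a0 A'C A'_lt.
have [D WD] : exists D, holder_with alpha D W.
  by eexists; exact: admissible_holder aW.
pose V : RN R -> R := W \o RN_incl.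
have AC : holder_with alpha C A by move=> x y; rewrite -!A'_ext.
have VD : holder_with alpha D V by move=> x y; exact: WD.
(* Replacing an infinite [a] by [z0] strictly raises [A'] and does not lower [W], while the value at
   [z0] is at most [c]. *)
have strict (a : \bar R) (x : eRN R) : a \isn't a fin_num ->
    A' (seq_cons a x) + W (seq_cons a x) - W x < c.
  move=> ainf; have subst0 s : seq_cons s x = seq_subst (seq_cons a x) 0 s.
    by apply/funext => -[].
  apply: lt_le_trans ((cal x).2 z0%:E).
  rewrite ltrD2r (subst0 a) (subst0 z0%:E) ltr_leD//; last exact: aW.2.
  exact: A'_lt_infinite.
have cal_real (x : RN R) : exists a : R, A' (seq_cons a%:E (RN_incl x)) +
    W (seq_cons a%:E (RN_incl x)) - W (RN_incl x) = c.
  have [[a ac] _] := cal (RN_incl x).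
  have afin : a \is a fin_num.
    apply: contrapT => /negP ainf.
    by have := strict _ (RN_incl x) ainf; rewrite ac ltxx.
  by exists (fine a); rewrite fineK.
have calV : calibrated A V c.
  move=> x; split.
    by have [a aE] := cal_real x; exists a; rewrite /V/= -A'_ext RN_incl_cons.
  by move=> a; rewrite /V/= -A'_ext RN_incl_cons; exact: (cal _).2.
have [MA A'M] := holder_with_bounded (point : eRN R) a0 mdist_eRN_le1 A'C.
have [MW WM] := holder_with_bounded (point : eRN R) a0 mdist_eRN_le1 WD.
pose M := Num.max MA MW.
have A'M' x : `|A' x| <= M by rewrite le_max A'M.
have WM' x : `|W x| <= M by rewrite le_max WM orbT.
have sub (x : eRN R) : A' x + W x - W (seq_shift x) <= c.
  by rewrite -{1 2}(seq_cons_eta x); exact: (cal _).2.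
have cA' : continuous A' := holder_with_continuous a0 A'C.
have cW : continuous W := holder_with_continuous a0 WD.
(* The periodic sequences are real, so they serve for both spaces and both maximal values equal
   [c]. *)
have approx := periodic_approximation a0 A'C WM cal_real.
have maxE : max_value (eRN R) seq_shift A' = c.
  apply: (max_value_subaction (@eRN_shift_continuous R) cA' cW A'M' WM' sub).
  move=> e /approx[n [z [zn ce]]]; exists n, (RN_incl z); split.
    by rewrite -RN_incl_iter_shift zn.
  by under eq_bigr do rewrite -RN_incl_iter_shift.
have maxRN : max_value (RN R) seq_shift A = c.
  apply: (max_value_subaction (@RN_shift_continuous R)
    (holder_with_continuous a0 AC) (holder_with_continuous a0 VD)
    (M := M) (W := V)).
  - by move=> x; rewrite -A'_ext.
  - by move=> x; exact: WM'.
  - by move=> x; rewrite -A'_ext; exact: (sub (RN_incl x)).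
  - move=> e /approx[n [z [zn ce]]]; exists n, z; split => //.
    by under eq_bigr do rewrite -A'_ext.
rewrite maxRN; split; first last.
- by move=> lambda; exact: (eigenvalue_asymptotics a0 f_gt0 f_cont AC VD calV).
- by exists V; split => //; exact: (holder_with_continuous a0 VD).
move=> mu [mu_inv]; rewrite maxE => muA'.
pose U : set (eRN R) := [set x | A' x + W x - W (seq_shift x) < c].
have cG : continuous (fun x => A' x + W x - W (seq_shift x)).
  move=> x; exact: (cvgB (cvgD (cA' x) (cW x))
    (continuous_comp (@eRN_shift_continuous R x) (cW (seq_shift x)))).
have oU : open U.
  by apply: ((continuousP _).1 cG [set r | r < c]); exact: open_lt.
have pre_open n (E : set (eRN R)) :
    open E -> open (iter n seq_shift @^-1` E : set (eRN R)).
  move: E; apply/continuousP.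
  exact: (@iter_continuous (eRN R) _ n (@eRN_shift_continuous R)).
have U0 : mu U = 0%E.
  exact: (maximizing_calibrated (@eRN_shift_continuous R) cA' cW A'M' WM' sub
    mu_inv muA').
have infU : infinite_at 0%N `<=` U.
  by move=> x xinf; have := strict _ (seq_shift x) xinf; rewrite seq_cons_eta.
have inv_iter n (E : set (eRN R)) : open E -> mu (iter n seq_shift @^-1` E) = mu E.
  move=> oE; elim: n => // n <-; rewrite -[RHS]mu_inv; last first.
    by apply: open_borel; exact: pre_open.
  by congr (mu _); apply/funext => x; rewrite /preimage/= -iterSr.
have preU n := pre_open n U oU.
have preU0 n : mu (iter n seq_shift @^-1` U) = 0%E by rewrite inv_iter.
have pre_inf n : infinite_at n `<=` iter n seq_shift @^-1` U.
  by rewrite infinite_at_shift => x; exact: infU.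
(* A support point with infinite n-th coordinate would lie in the n-th preimage of [U], which is
   open and null. *)
split.
  move=> x xsupp; exists (eRN_retract x) => //; apply: eRN_retractK => -[n _ xn].
  by have := xsupp _ (preU n) (pre_inf n x xn); rewrite preU0 ltxx.
have mI := @measurable_infinite_somewhere R.
have I0 : mu infinite_somewhere = 0%E.
  apply/(measure_negligible mI); apply: negligible_bigcup => n.
  exists (iter n seq_shift @^-1` U).
  by split; [exact: open_borel|exact: preU0|exact: pre_inf].
have mr := @measurable_eRN_retract R.
(* As [mu] does not charge [infinite_somewhere], the image under the retraction is [mu] seen on real
   sequences; all identities below need checking only off this null set. *)
have [nu nuE] := image_probability mu mr.
have mincl := continuous_borel (@RN_incl_continuous R).
have pre_r (E : set (borel (RN R))) :
    measurable E -> measurable (eRN_retract @^-1` E : set (borel (eRN R))).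
  by move=> mE; rewrite -[X in measurable X]setTI; exact: mr.
exists nu; split=> [E mE|].
  rewrite nuE; apply: (measure_eq_off_null mI) => //.
    by apply: pre_r; rewrite -[X in measurable X]setTI; exact: mincl.
  by move=> x xfin; rewrite /= eRN_retractK.
have mshift := continuous_borel (@RN_shift_continuous R).
have meshift := continuous_borel (@eRN_shift_continuous R).
split=> [E mE|].
  rewrite !nuE -[RHS]mu_inv; last exact: pre_r.
  apply: (measure_eq_off_null mI) => //.
  - by apply: pre_r; rewrite -[X in measurable X]setTI; exact: mshift.
  - by rewrite -[X in measurable X]setTI; apply: meshift => //; exact: pre_r.
  - by move=> x xfin; rewrite /= eRN_retract_shift.
have mA : measurable_fun setT (A : borel (RN R) -> R).
  exact: continuous_borel_real (holder_with_continuous a0 AC).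
have mA' : measurable_fun setT (A' : borel (eRN R) -> R).
  exact: continuous_borel_real cA'.
have mAr : measurable_fun setT (A \o eRN_retract : borel (eRN R) -> R).
  exact: (measurableT_comp mA mr).
rewrite maxRN -muA' (Rintegral_image mr mA (fun E _ => nuE E)); last first.
  by apply: (integrable_bounded mu mAr (M := M)) => x; rewrite /= -A'_ext.
rewrite /Rintegral; congr fine; apply: ae_eq_integral => //.
- exact/measurable_EFinP.
- exact/measurable_EFinP.
exists infinite_somewhere; split => // x /= /not_implyP[_ Ax].
by apply: contrapT => xfin; apply: Ax; rewrite -A'_ext eRN_retractK.
Qed.
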